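(* For every ordered graph $F$ there exist an ordered graph $H$ and a system of copies $\mathscr{H}_F\subseteq\binom{H}{F}$ with clean intersections such that for every colouring $\phi\colon E(H)\to\mathbb{N}$ there is a copy $F_\star\in\mathscr{H}_F$ such that the restriction of $\phi$ to $E(F_\star)$ is canonical. Moreover, $H$ has the same clique number as $F$ and, in case $F$ is not bipartite, $H$ also has the same odd girth as $F$. Finally, if $F$ is connected, then any two vertices of any copy $F_\star\in\mathscr{H}_F$ have the same distance in $H$ as in $F_\star$.
   Context: All graphs are finite and simple. An ordered graph is a graph together with a total order on its vertex set. For ordered graphs $F$ and $H$, $\binom{H}{F}$ denotes the set of all induced subgraphs of $H$ that are isomorphic to $F$ by an order-preserving isomorphism. Two graphs $F,F'$ have a clean intersection if $|V(F)\cap V(F')|\le 1$ or $V(F)\cap V(F')\in E(F)\cap E(F')$. A family of graphs has clean intersections if any two distinct members have a clean intersection. A colouring $\phi\colon E(F)\to\mathbb{N}$ of an ordered graph $F$ is canonical if one of the following holds: (i) all edges have the same colour (monochromatic); (ii) for all $e,e'\in E(F)$: $\phi(e)=\phi(e')\Leftrightarrow\min e=\min e'$ (min-coloured); (iii) for all $e,e'\in E(F)$: $\phi(e)=\phi(e')\Leftrightarrow\max e=\max e'$ (max-coloured); (iv) all edges have distinct colours (rainbow). The odd girth of a graph is the length of a shortest odd cycle (and $\infty$ if the graph is bipartite). *)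

(* Defs.v *)
From HB Require Import structures.
From mathcomp Require Import all_boot all_order.

Set Implicit Arguments.
Unset Strict Implicit.
Unset Printing Implicit Defensive.

Import Order.TTheory.
Local Open Scope order_scope.

(* The first k < n satisfying P; None stands for infinity. *)
Definition least (n : nat) (P : pred nat) : option nat :=
  ohead [seq k <- iota 0 n | P k].

(* An ordered graph is a graph whose vertex type is a finOrderType. *)
Record graph (V : finType) : Type := Graph {
  adj :> rel V;
  adj_sym : symmetric adj;
  adj_irr : irreflexive adj
}.

Section Graphs.
Variable V : finType.
Implicit Types (G : graph V) (A B K : {set V}).

Definition edges G : {set {set V}} :=
  [set [set x; y] | x in V, y in V & G x y].

Definition induced_adj G A : rel V :=
  [rel x y | [&& x \in A, y \in A & G x y]].

Fact induced_adj_sym G A : symmetric (induced_adj G A).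
Proof. by move=> x y; rewrite /induced_adj /= adj_sym andbCA. Qed.

Fact induced_adj_irr G A : irreflexive (induced_adj G A).
Proof. by move=> x; rewrite /induced_adj /= adj_irr !andbF. Qed.

(* The subgraph of G induced by A, kept on the ambient vertex type: its vertex
   set is A, and the points outside A are isolated.  It is only used through
   its edges and through distances between points of A, which the isolated
   points do not affect. *)
Definition induced G A : graph V :=
  Graph (@induced_adj_sym G A) (@induced_adj_irr G A).

(* Clean intersection of the subgraphs of G induced by A and B. *)
Definition clean_intersection G A B : Prop :=
  (#|A :&: B| <= 1)%N \/
  A :&: B \in edges (induced G A) :&: edges (induced G B).

Definition clique G K : bool :=
  [forall x in K, forall y in K, (x != y) ==> G x y].

Definition clique_number G : nat := (\max_(K : {set V} | clique G K) #|K|)%N.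

Definition bipartite G : bool :=
  [exists A : {set V}, forall x, forall y,
     G x y ==> ((x \in A) != (y \in A))].

Definition has_cycle G (k : nat) : bool :=
  (2 < k)%N && [exists c : k.-tuple V, cycle G c && uniq c].

(* A cycle has at most #|V| vertices, so the bound in least is harmless. *)
Definition odd_girth G : option nat :=
  least #|V|.+1 (fun k => odd k && has_cycle G k).

Definition connected G : Prop := forall x y, connect G x y.

(* There is a path with k edges from x to y. *)
Definition has_path G (x y : V) (k : nat) : bool :=
  [exists p : k.-tuple V, [&& path G x p, last x p == y & uniq (x :: p)]].

(* A path has fewer than #|V| edges. *)
Definition distance G (x y : V) : option nat := least #|V| (has_path G x y).

End Graphs.

Section OrderedGraphs.
Variables (d : Order.disp_t) (V : finOrderType d).
Implicit Types (G : graph V) (e : {set V}).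

(* The option is None only for the empty set, which is never an edge. *)
Definition min_vertex e : option V := [pick x in e | [forall y in e, x <= y]].
Definition max_vertex e : option V := [pick x in e | [forall y in e, y <= x]].

(* Colourings of E(G) are total functions on sets of vertices, of which only
   the values on edges matter. *)
Section Colouring.
Variables (G : graph V) (phi : {set V} -> nat).

Definition monochromatic : Prop :=
  {in edges G &, forall e e', phi e = phi e'}.

Definition min_coloured : Prop :=
  {in edges G &, forall e e', phi e = phi e' <-> min_vertex e = min_vertex e'}.

Definition max_coloured : Prop :=
  {in edges G &, forall e e', phi e = phi e' <-> max_vertex e = max_vertex e'}.

Definition rainbow : Prop := {in edges G &, injective phi}.

Definition canonical : Prop :=
  [\/ monochromatic, min_coloured, max_coloured | rainbow].
End Colouring.

End OrderedGraphs.

(* A is the vertex set of an induced subgraph of H isomorphic to F by an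
   order-preserving isomorphism.  An induced subgraph is determined by its
   vertex set, so sets of induced subgraphs are represented by sets of sets. *)
Definition copy (d d' : Order.disp_t) (V : finOrderType d)
    (W : finOrderType d') (F : graph V) (H : graph W) (A : {set W}) : Prop :=
  exists f : V -> W,
    [/\ {homo f : x y / x < y},
        [set f x | x : V] = A
      & forall x y, H (f x) (f y) = F x y].

(* Main.v *)
(** Partite construction over a graph [G] whose colourings always have a
canonical copy of [F]; the first [G] is a complete graph, by Erdos-Rado. A
picture [P] over [G] is built from lifts of the copies of [F] in [G], so that
every colouring of [P] reflects a colouring of [G]: over each copy of [F] in
[G] some lift has the same partition into colour classes. To this end the
edges of [G] are treated one after the other by a canonical partite lemma,
which makes the colour of the edges over [e] depend injectively on their part
over a root [R e], a subset of [e] (nothing, one end, or all of [e]). Two edges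
of [G] with the same root then always or never agree, by a two-colouring taken
along in the partite lemma; for different roots agreement is rare, and since in
the initial picture every edge lies in many otherwise disjoint lifts, some
lift avoids all accidental agreements.

Lifts of different copies of a picture meet in an edge of [G] only, hence
cleanly once the copies of [F] in [G] are induced. A cycle of [P] that projects
injectively to an induced cycle of [G] meets each amalgamation in at most two
consecutive vertices, so it lies in the initial picture, which maps to [F].
Hence one passage from [G] to [P] increases by one the length up to which odd
cycles and distances are those of [F], and the construction is iterated. *)

From HB Require Import structures.
Require Import Defs.
From mathcomp Require Import all_boot all_order zify.

Set Implicit Arguments.
Unset Strict Implicit.
Unset Printing Implicit Defensive.

Import Order.TTheory.

(** * Ramsey theorems *)

(** A colouring of a picture need not come from a colouring of [G]: the edges over one edge of [G]
    may receive many colours. What can be carried over is the equality pattern on a single lift, and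
    canonicity depends on nothing else. The colour that [e] receives in [G] is its root together
    with the function that computes the colours of the edges over [e] from their parts over the
    root. The obstacle is the comparison of two edges of [G]. If the root of [e] lies in [e'], an
    edge over [e'] contains a part over this root, and whether its colour is the one computed from
    that part is a two-colouring of the edges over [e'], which can be made constant. If the root
    does not lie in [e'], a vertex of the root can be moved while the edge over [e'] stays fixed;
    the colour over [e] then changes, so that agreement is an accident. In a complete graph the
    copies of [F] are in general not induced; the first passage makes them induced, and only later
    ones give clean intersections. Shortest odd cycles and shortest paths of [F] have at most [#|V|]
    vertices, which bounds the number of passages. *)

Lemma pigeonhole (C : finType) (m : nat) :
  exists M, forall (T : Type) (s : seq T) (f : T -> C), M <= size s ->
    exists c, m <= count (fun x => f x == c) s.
Proof.
exists (#|C| * m).+1 => T s f szs; apply/existsP.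
apply: contraLR szs; rewrite negb_exists -leqNgt => /forallP lt_m.
have -> : size s = \sum_c count (fun x => f x == c) s.
  elim: {lt_m} s => [|x s /= ->]; first by rewrite big1.
  have eq1 : \sum_c (f x == c) = 1.
    by rewrite (bigD1 (f x)) //= eqxx big1 // => c; rewrite eq_sym => /negbTE->.
  by rewrite big_split /= eq1.
rewrite -sum_nat_const; apply: leq_sum => c _.
by rewrite ltnW // ltnNge lt_m.
Qed.

Section ChainPick.
Variables (T : eqType) (K : Type) (good : K -> seq T -> seq T -> Prop).
Hypothesis good_sub : forall k X s s', subseq s' s -> good k X s -> good k X s'.
Hypothesis good_large : forall l m, exists M, forall k X s,
  size X = l -> M <= size s -> exists s', [/\ subseq s' s, m <= size s' & good k X s'].

(* Pick elements greedily, shrinking the set of candidates each time so that it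
   is good for what has been picked so far. *)
Lemma chain_pick n l : exists N, forall k X s, size X = l -> N <= size s ->
  exists Y, [/\ subseq Y s, size Y = n &
    forall Y1 y Y2, Y = Y1 ++ y :: Y2 -> good k (X ++ rcons Y1 y) Y2].
Proof.
elim: n l => [|n IHn] l.
  exists 0 => k X s _ _; exists [::]; split=> //; first exact: sub0seq.
  by case.
have [N HN] := IHn l.+1; have [M HM] := good_large l.+1 N.
exists M.+1 => k X [//|x s] szX szs.
have szX' : size (rcons X x) = l.+1 by rewrite size_rcons szX.
have [s' [ss' szs' gs']] := HM k _ _ szX' szs.
have [Y [sY szY gY]] := HN k _ _ szX' szs'.
exists (x :: Y); split=> /=.
- by rewrite eqxx (subseq_trans sY).
- by rewrite szY.
move=> [|y1 Y1] y Y2 /= [<- eY].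
  by rewrite -eY cats1; apply: good_sub gs'.
by rewrite -cat_rcons; apply: gY.
Qed.
End ChainPick.

Lemma pairwise_split (T : Type) (r : rel T) (s : seq T) :
  (forall s1 x s2, s = s1 ++ x :: s2 -> all (r x) s2) -> pairwise r s.
Proof.
elim: s => //= x s IHs rs; rewrite (rs [::] x s) //=.
by apply: IHs => s1 y s2 es; apply: (rs (x :: s1) y); rewrite es.
Qed.

Lemma pairwise_neq (T : eqType) (r : rel T) (s : seq T) x y :
  pairwise r s -> x \in s -> y \in s -> x != y -> r x y || r y x.
Proof.
elim: s => //= z s IHs /andP[/allP rz rs]; rewrite !inE.
case/predU1P=> [->|xs] /predU1P[->|ys]; rewrite ?eqxx // => nxy.
- by rewrite rz.
- by rewrite rz // orbT.
exact: IHs.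
Qed.

(** Greedy picking makes the colour of a pair depend on its earlier member alone; the pigeonhole
    principle then applies to that colour. *)
Lemma ramsey2 (T : eqType) (C : finType) (m : nat) :
  exists N, forall (s : seq T) (chi : T -> T -> C), N <= size s ->
    exists Y c, [/\ subseq Y s, size Y = m & pairwise (fun x y => chi x y == c) Y].
Proof.
have [n0 Hn0] := pigeonhole C m.
pose good (chi : T -> T -> C) (X s : seq T) := if X is x0 :: X' then
  {in s &, forall y y', chi (last x0 X') y = chi (last x0 X') y'} else True.
have good_sub chi X s s' : subseq s' s -> good chi X s -> good chi X s'.
  by case: X => // x0 X' /mem_subseq ss gs y y' /ss ys /ss; apply: gs.
have large l k : exists M, forall chi X s, size X = l -> M <= size s ->
    exists s', [/\ subseq s' s, k <= size s' & good chi X s'].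
  have [M HM] := pigeonhole C k.
  exists (maxn M k) => chi [|x0 X] s _; rewrite geq_max => /andP[Ms ks].
    by exists s.
  have [c kc] := HM _ s (chi (last x0 X)) Ms.
  exists [seq y <- s | chi (last x0 X) y == c]; split; rewrite ?size_filter //.
    exact: filter_subseq.
  by move=> y y'; rewrite !mem_filter => /andP[/eqP-> _] /andP[/eqP-> _].
(* The last pick is the common partner against which the colours of the earlier ones are read. *)
have [N HN] := chain_pick good_sub large n0.+1 0.
exists N.+1 => s chi ltNs.
have [||Y [sY szY gY]] := HN chi [::] s; rewrite ?(ltnW ltNs) //.
have [x0 x0s] : exists x, x \in s by case: (s) ltNs => // x ? _; exists x; rewrite inE eqxx.
have [|c mc] := Hn0 _ Y (fun y => chi y (last x0 Y)); first by rewrite szY.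
exists (take m [seq y <- Y | chi y (last x0 Y) == c]), c; split.
- by rewrite (subseq_trans (take_subseq _ _)) // (subseq_trans (filter_subseq _ _)).
- by rewrite size_takel // size_filter.
apply: (subseq_pairwise (take_subseq _ _)).
have pY : pairwise (fun x y => chi x y == chi x (last x0 Y)) Y.
  apply/pairwise_split => s1 x s2 eY; apply/allP => y ys2.
  have gx : {in s2 &, forall y y', chi x y = chi x y'}.
    by have := gY _ _ _ eY; case: (s1) => [|x1 s1'] //=; rewrite last_rcons.
  rewrite eY last_cat /=; apply/eqP/gx => //.
  by case: s2 ys2 {eY gx} => //= z s2 _; apply: mem_last.
apply: sub_in_pairwise (filter_all _ _) (pairwise_filter _ pY) => x y /eqP xc _.
by rewrite xc.
Qed.

(** * Canonical patterns of a finite family of functions of one variable *)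

Section OneDim.
Variables (T : eqType) (I : finType).

(** The canonical patterns in dimension one, for a whole family: any two functions coincide or have
    disjoint ranges. This joint form is what inductions over coordinates need. *)
Definition tame (F : I -> T -> nat) (s : seq T) : Prop :=
  (forall u, {in s &, forall x y, F u x = F u y} \/ {in s &, injective (F u)}) /\
  (forall u v, {in s, F u =1 F v} \/ {in s &, forall x y, F u x <> F v y}).

Lemma tame_sub F s s' : subseq s' s -> tame F s -> tame F s'.
Proof.
move=> /mem_subseq ss [h1 h2]; split=> [u|u v].
  by case: (h1 u) => h; [left|right] => x y /ss xs /ss; apply: h.
case: (h2 u v) => h; [left => x /ss|right => x y /ss xs /ss]; exact: h.
Qed.

Lemma tame_large m : exists M, forall F s, M <= size s ->
  exists s', [/\ subseq s' s, size s' = m & tame F s'].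
Proof.
(* A pair is coloured by all equalities among the values of the family at its two points. The
   summand 3 provides the points [x], [y], [z] on which the homogeneous pattern is compared with
   itself. *)
have [N HN] := ramsey2 T {ffun I * I -> bool * bool * bool} m.+3.
exists N => F s /HN-/(_ (fun x y => [ffun p =>
  (F p.1 x == F p.2 y, F p.1 x == F p.2 x, F p.1 y == F p.2 y)])) [Y [c [sY szY pY]]].
exists (take m Y); split; first exact: subseq_trans (take_subseq _ _) sY.
  by rewrite size_takel // szY !leqW.
apply: tame_sub (take_subseq _ _) _.
pose a u v := (c (u, v)).1.1; pose d u v := (c (u, v)).1.2.
pose e u v := (c (u, v)).2.
pose R x y := forall u v, [/\ (F u x == F v y) = a u v, (F u x == F v x) = d u v
  & (F u y == F v y) = e u v].
have cP x y : x \in Y -> y \in Y -> x != y -> R x y \/ R y x.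
  move=> xY yY nxy; case/orP: (pairwise_neq pY xY yY nxy) => /eqP/ffunP cE;
    [left|right] => u v; have := cE (u, v); rewrite ffunE /a /d /e => <- /=; by [].
have [x [y [z [xY Rxy Rxz Ryz]]]] : exists x y z,
    [/\ x \in Y, R x y, R x z & R y z].
  case: Y {sY cP} szY pY => [|x [|y [|z Y]]] //= _ /and4P[/and3P[xy xz _] /andP[yz _] _ _].
  exists x, y, z; rewrite inE eqxx; split=> // u v;
    [have /eqP/ffunP/(_ (u, v)) := xy|have /eqP/ffunP/(_ (u, v)) := xz
    |have /eqP/ffunP/(_ (u, v)) := yz]; by rewrite ffunE /a /d /e => <-.
have de u v : d u v = e u v by have [_ _ <-] := Rxy u v; have [_ <- _] := Ryz u v.
have dC u v : d u v = d v u.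
  by have [_ <- _] := Rxy u v; have [_ <- _] := Rxy v u; rewrite eq_sym.
have diag u v w : w \in Y -> (F u w == F v w) = d u v.
  move=> wY; have [nwx|] := boolP (w != x).
    by case: (cP _ _ wY xY nwx) => /(_ u v)[_ d1 e1]; rewrite ?d1 ?e1 ?de.
  move/negPn/eqP=> ->.
  by have [_ -> _] := Rxy u v.
(* If [F u] at [x] equals [F v] at [y] and at [z], then [F v] repeats a value; by homogeneity it
   also repeats it at [x]. *)
have ad u v : a u v -> d u v.
  move=> auv; have [] := Rxy u v; rewrite auv => /eqP exy <- _.
  have [] := Rxz u v; rewrite auv => /eqP exz _ _.
  have [] := Ryz u v; rewrite auv => /eqP eyz _ _.
  have [] := Ryz v v; rewrite -exy -exz eqxx => avv _ _.
  have [] := Rxy v v; rewrite -avv => /eqP -> _ _.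
  by rewrite exy.
split=> [u|u v].
  case auu: (a u u); [left|right] => x' y' xY' yY'.
    have [->//|/(cP _ _ xY' yY')] := eqVneq x' y'.
    by case=> /(_ u u) []; rewrite auu => /eqP.
  move=> exy; apply/eqP; apply: contraFT auu => /(cP _ _ xY' yY').
  by case=> /(_ u u) [<-]; rewrite exy eqxx.
case duv: (d u v); [left => w wY|right => x' y' xY' yY' exy].
  by apply/eqP; rewrite diag.
move/negP: duv; apply; have [exy'|/(cP _ _ xY' yY')] := eqVneq x' y'.
  by rewrite -(diag u v x') // {2}exy' exy.
case=> [/(_ u v) [/esym auv _ _]|/(_ v u) [/esym auv _ _]].
  by apply: ad; rewrite auv exy.
by rewrite dC; apply: ad; rewrite auv exy.
Qed.
End OneDim.

(** * The canonical Ramsey theorem for pairs *)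

Lemma rcons_take_last (T : Type) (x0 : T) n (s : seq T) :
  size s = n.+1 -> s = rcons (take n s) (last x0 s).
Proof.
elim/last_ind: s => [|s x _] //; rewrite size_rcons last_rcons => -[<-].
by rewrite -!cats1 take_size_cat.
Qed.

(* The sequence is picked so that for every member y the
   rows phi x, x <= y, and the values phi x t, x < t <= y, are tame on the later
   members. *)
Lemma canonical_ramsey n : exists N, forall phi : nat -> nat -> nat,
  exists X R1 R2, [/\ size X = n, sorted ltn X, all (gtn N) X &
    {in X &, forall i j, {in X &, forall i' j', i < j -> i' < j' ->
      (phi i j == phi i' j') = (R1 ==> (i == i')) && (R2 ==> (j == j'))}}].
Proof.
pose Fam (phi : nat -> nat -> nat) (X : seq nat) (u : 'I_(size X) + 'I_(size X) * 'I_(size X)) t :=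
  match u with inl a => phi (nth 0 X a) t
             | inr ab => phi (nth 0 X ab.1) (nth 0 X ab.2) end.
have good_sub phi X s s' : subseq s' s -> tame (Fam phi X) s -> tame (Fam phi X) s'.
  exact: tame_sub.
have large l m : exists M, forall phi X s, size X = l -> M <= size s ->
    exists s', [/\ subseq s' s, m <= size s' & tame (Fam phi X) s'].
  have [M HM] := tame_large nat ('I_l + 'I_l * 'I_l)%type m.
  exists M => phi X s eX; move: (Fam phi X); rewrite eX => F /HM-/(_ F).
  by case=> s' [ss' <- t']; exists s'.
have [n0 Hn0] := ramsey2 nat (bool * bool)%type n.
have [N HN] := chain_pick good_sub large n0.+1 0.
exists N => phi.
have [||Y [sY szY tY]] := HN phi [::] (iota 0 N); rewrite ?size_iota //.
have soY : sorted ltn Y by apply: subseq_sorted sY (iota_ltn_sorted _ _); apply: ltn_trans.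
have {}tY y : y \in Y -> exists2 X, {in Y, forall w, w <= y -> w \in X}
    & tame (Fam phi X) [seq t <- Y | y < t].
  move=> yY; have eY := tY; case/splitPr: yY eY soY => Y1 Y2 /(_ _ _ _ erefl) /= tY2.
  rewrite sorted_pairwise; last exact: ltn_trans.
  rewrite pairwise_cat /= => /and3P[/allrelP s12 _ /andP[/allP s2 _]].
  exists (rcons Y1 y).
    move=> w; rewrite mem_cat mem_rcons !inE => /or3P[->|->|/s2]; rewrite ?orbT //.
    by move=> /= lt_yw; rewrite leqNgt lt_yw.
  apply: tame_sub tY2; rewrite filter_cat /= ltnn.
  rewrite (@eq_in_filter _ _ pred0 Y1) ?filter_pred0 ?filter_subseq // => w wY1.
  by apply/negbTE; rewrite -leqNgt ltnW //; apply: s12; rewrite ?mem_head.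
(* [z] is later than all of [Y0] and serves as reference: comparing [phi y t] with [phi y z] tells
   whether a row is constant or injective, comparing [phi y z] with [phi t z] whether two rows
   coincide. *)
pose z := last 0 Y; pose Y0 := take n0 Y.
have Y0lt : {in Y0, forall y, y \in Y /\ y < z}.
  have eY : Y = rcons Y0 z := rcons_take_last 0 szY.
  move: soY; rewrite sorted_pairwise; last exact: ltn_trans.
  rewrite {1}eY pairwise_rcons => /andP[/allP ltz _] y yY0; split; last exact: ltz.
  by rewrite eY mem_rcons inE yY0 orbT.
have zY : z \in Y by rewrite /z; case: (Y) szY => // a s _; apply: mem_last.
have [|X [c [sX szX pX]]] := Hn0 Y0 (fun y t => (phi y t == phi y z, phi y z == phi t z)).
  by rewrite size_takel // szY.
have XP y : y \in X -> y \in Y /\ y < z by move/(mem_subseq sX)/Y0lt.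
have Ylt : all (gtn N) Y.
  by apply/allP => y /(mem_subseq sY); rewrite mem_iota.
(* Constant rows ([c.1]) concern the second coordinate and coinciding rows ([c.2]) the first, hence
   the swap. *)
exists X, (~~ c.2), (~~ c.1); split=> //.
- apply: subseq_sorted soY; first exact: ltn_trans.
  exact: subseq_trans sX (take_subseq _ _).
- by apply/allP => y /XP[/(allP Ylt)].
have Xlt : pairwise ltn X.
  rewrite -sorted_pairwise; last exact: ltn_trans.
  apply: subseq_sorted soY; first exact: ltn_trans.
  exact: subseq_trans sX (take_subseq _ _).
have Xpair y t : y \in X -> t \in X -> y < t ->
    (phi y t == phi y z) = c.1 /\ (phi y z == phi t z) = c.2.
  move=> yX tX lt_yt.
  have pX' : pairwise [rel y t | ((phi y t == phi y z, phi y z == phi t z) == c) && (y < t)] X.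
    by rewrite pairwise_relI pX.
  have := pairwise_neq pX' yX tX; rewrite (ltn_eqF lt_yt) => /(_ isT) /=.
  by rewrite lt_yt ltnNge ltnW //= andbF orbF andbT => /eqP<-.
have row y : y \in Y -> {in [seq t <- Y | y < t] &, forall t t', phi y t = phi y t'}
    \/ {in [seq t <- Y | y < t] &, injective (phi y)}.
  move=> yY; have [X0 pX0 [tX0 _]] := tY y yY.
  have yX0 : index y X0 < size X0 by rewrite index_mem pX0.
  by have := tX0 (inl (Ordinal yX0)); rewrite /Fam /= nth_index // -index_mem.
have rows y y' : y \in Y -> y' \in Y -> y <= y' ->
    {in [seq t <- Y | y' < t], phi y =1 phi y'}
    \/ {in [seq t <- Y | y' < t] &, forall t t', phi y t <> phi y' t'}.
  move=> yY y'Y le_yy; have [X0 pX0 [_ tX0]] := tY y' y'Y.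
  have yX0 : index y X0 < size X0 by rewrite index_mem pX0.
  have y'X0 : index y' X0 < size X0 by rewrite index_mem pX0.
  have := tX0 (inl (Ordinal yX0)) (inl (Ordinal y'X0)).
  by rewrite /Fam /= !nth_index // -index_mem.
have vals y t y' : y \in Y -> t \in Y -> y' \in Y -> y <= y' -> t <= y' ->
    {in [seq t <- Y | y' < t], forall t', phi y t = phi y' t'}
    \/ {in [seq t <- Y | y' < t], forall t', phi y t <> phi y' t'}.
  move=> yY tYY y'Y le_yy le_ty; have [X0 pX0 [_ tX0]] := tY y' y'Y.
  have yX0 : index y X0 < size X0 by rewrite index_mem pX0.
  have tX0' : index t X0 < size X0 by rewrite index_mem pX0.
  have y'X0 : index y' X0 < size X0 by rewrite index_mem pX0.
  have := tX0 (inr (Ordinal yX0, Ordinal tX0')) (inl (Ordinal y'X0)).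
  rewrite /Fam /= !nth_index -?index_mem // => -[] H; [left|right] => w Hw.
    exact: H.
  exact: (H _ _ Hw Hw).
have fut y t : y < t -> t \in Y -> t \in [seq t <- Y | y < t].
  by rewrite mem_filter => ->.
have inj y t : y \in X -> t \in X -> y < t -> ~~ c.1 ->
    {in [seq t <- Y | y < t] &, injective (phi y)}.
  move=> yX tX lt_yt nc1; have [yY yz] := XP y yX; have [tYY tz] := XP t tX.
  case: (row y yY) => // /(_ t z (fut _ _ lt_yt tYY) (fut _ _ yz zY)) e.
  by case/negP: nc1; have [<- _] := Xpair y t yX tX lt_yt; rewrite e.
have row1 y t : y \in X -> t \in X -> y < t -> c.1 -> phi y t = phi y z.
  by move=> yX tX lt_yt c1; apply/eqP; have [-> _] := Xpair y t yX tX lt_yt.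
have id2 y y' t : y \in X -> y' \in X -> y < y' -> c.2 -> t \in Y -> y' < t ->
    phi y t = phi y' t.
  move=> yX y'X lt_yy c2 tYY lt_yt; have [yY yz] := XP y yX; have [y'Y y'z] := XP y' y'X.
  case: (rows y y' yY y'Y (ltnW lt_yy)) => [->//|]; first exact: fut.
  move=> /(_ z z (fut _ _ y'z zY) (fut _ _ y'z zY)) /eqP.
  by have [_ ->] := Xpair y y' yX y'X lt_yy; rewrite c2.
(* Only a value [phi y t] with [t <= y'] escapes the comparison of rows. If such a value met the row
   of [y'], it would equal the whole row, against injectivity. *)
have dis y y' t t' : y \in X -> y' \in X -> y < y' -> ~~ c.2 -> t \in X -> t' \in X ->
   y < t -> y' < t' -> phi y t <> phi y' t'.
  move=> yX y'X lt_yy nc2 tX t'X lt_yt lt_yt'.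
  have [[yY yz] [y'Y y'z]] := (XP y yX, XP y' y'X).
  have [[tYY tz] [t'Y t'z]] := (XP t tX, XP t' t'X).
  have nyz : phi y z <> phi y' z.
    by apply/eqP; have [_ ->] := Xpair y y' yX y'X lt_yy.
  have [c1|nc1] := boolP c.1; first by rewrite !row1.
  case: (rows y y' yY y'Y (ltnW lt_yy)) => [/(_ z (fut _ _ y'z zY))//|H].
  have [le_ty|lt_y't] := leqP t y'; last by apply: H; apply: fut.
  case: (vals y t y' yY tYY y'Y (ltnW lt_yy) le_ty) => H'; last exact/H'/fut.
  have e : phi y' t' = phi y' z by rewrite -!H' // fut.
  have := inj y' t' y'X t'X lt_yt' nc1 t' z (fut _ _ lt_yt' t'Y) (fut _ _ y'z zY) e.
  by move=> et; rewrite et ltnn in t'z.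
move=> i j iX jX i' j' i'X j'X lij lij'.
wlog: i j iX jX i' j' i'X j'X lij lij' / i <= i'.
  move=> H; case: (leqP i i') => [|/ltnW] le_ii; first exact: H.
  by rewrite eq_sym (eq_sym i) (eq_sym j); apply: H.
have same y t t' : y \in X -> t \in X -> t' \in X -> y < t -> y < t' ->
    (phi y t == phi y t') = (~~ c.1 ==> (t == t')).
  move=> yX tX t'X lt_yt lt_yt'; have [[tYY _] [t'Y _]] := (XP t tX, XP t' t'X).
  have [c1|nc1] := boolP c.1 => /=; first by rewrite !row1 ?eqxx.
  by apply: (inj_in_eq (inj y t yX tX lt_yt nc1)); apply: fut.
rewrite leq_eqVlt => /predU1P[eii|lii].
  by rewrite -eii eqxx implybT same // eii.
rewrite (ltn_eqF lii) implybF negbK.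
case c2: c.2 => /=; last by apply/negP => /eqP; apply: dis => //; rewrite c2.
have [j'Y _] := XP _ j'X.
by rewrite -(id2 i i' j') // same // (ltn_trans lii).
Qed.

(** * The canonical Ramsey theorem for grids *)

Definition grid (n m : nat) (S : seq nat) : bool := (size S == n) && all (gtn m) S.

(** The inclusion of a subgrid: [h i] lists the values kept for coordinate [i]. *)
Fixpoint regrid (h : nat -> nat -> nat) (S : seq nat) : seq nat :=
  if S is t :: S' then h 0 t :: regrid (fun i => h i.+1) S' else [::].

Definition agree (n : nat) (J : pred nat) (S S' : seq nat) : bool :=
  all (fun i => J i ==> (nth 0 S i == nth 0 S' i)) (iota 0 n).

Lemma nth_regrid h S i : i < size S -> nth 0 (regrid h S) i = h i (nth 0 S i).
Proof. by elim: S h i => // t S IHS h [|i] //= ltiS; rewrite IHS. Qed.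

Lemma grid_cons n m t S : grid n.+1 m (t :: S) = (t < m) && grid n m S.
Proof. by rewrite /grid /= eqSS andbCA. Qed.

Lemma grid_sub n m m' S : m <= m' -> grid n m S -> grid n m' S.
Proof.
rewrite /grid => lemm /andP[-> /allP Sm]; apply/allP => t /Sm /= lt_tm.
exact: leq_trans lt_tm lemm.
Qed.

Lemma grid_regrid n m M h S : (forall i t, i < n -> t < m -> h i t < M) ->
  grid n m S -> grid n M (regrid h S).
Proof.
elim: n h S => [|n IHn] h [|t S] //= hM.
rewrite !grid_cons => /andP[tm gS]; rewrite hM //=; apply: IHn gS => i u lt_in; exact: hM.
Qed.

Lemma agree_refl n J S : agree n J S S.
Proof. by apply/allP => i _; rewrite eqxx implybT. Qed.

Lemma agree_cons n J t S t' S' : agree n.+1 J (t :: S) (t' :: S') =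
  (J 0 ==> (t == t')) && agree n (fun i => J i.+1) S S'.
Proof.
by rewrite /agree /= -[1]addn0 iotaDl all_map.
Qed.

(** A coordinate in [J] would give [m] distinct values below [c < m]. So a colouring with few
    colours, entered into the family of [canonical_grid], comes out constant on the subgrid. *)
Lemma bounded_agree n m c J (f : seq nat -> nat) :
  (forall S S', grid n m S -> grid n m S' -> (f S == f S') = agree n J S S') ->
  (forall S, grid n m S -> f S < c) -> c < m ->
  forall S S', grid n m S -> grid n m S' -> f S = f S'.
Proof.
move=> fE fc ltcm S S' gS gS'; apply/eqP; rewrite fE //.
apply/allP => i; rewrite mem_iota /= => lt_in; apply/implyP => Ji.
pose pt t := set_nth 0 (nseq n 0) i t.
have m0 : 0 < m := leq_ltn_trans (leq0n _) ltcm.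
have gpt t : t < m -> grid n m (pt t).
  move=> lt_tm; rewrite /grid size_set_nth size_nseq (maxn_idPr lt_in) eqxx.
  by apply/(all_nthP 0) => j; rewrite nth_set_nth /= nth_nseq; case: eqP => //; case: ifP.
have inj : injective (fun t : 'I_m => Ordinal (fc _ (gpt t (ltn_ord t)))).
  move=> t t' /(congr1 val) /= /eqP; rewrite fE ?gpt // => /allP/(_ i).
  by rewrite mem_iota Ji !nth_set_nth /= eqxx => /(_ lt_in)/eqP/val_inj.
by have := leq_card _ inj; rewrite !card_ord leqNgt ltcm.
Qed.

(* By induction on the dimension: the head coordinate is restricted to values on
   which all functions of it are tame, and the colouring of the remaining
   coordinates records, besides the class of such a function, whether it is
   constant. *)
Lemma canonical_grid n : forall (I : finType) m, exists M,
  forall phi : I -> seq nat -> nat, exists (h : nat -> nat -> nat) (cls : I -> nat)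
    (J : I -> pred nat),
  [/\ forall i, i < n -> {in gtn m &, injective (h i)},
      forall i t, i < n -> t < m -> h i t < M &
      forall p q S S', grid n m S -> grid n m S' ->
        (phi p (regrid h S) == phi q (regrid h S')) = (cls p == cls q) && agree n (J p) S S'].
Proof.
elim: n => [|n IHn] I m.
  exists 0 => phi; exists (fun _ => id), (phi^~ [::]), (fun _ => pred0); split=> //.
  by move=> p q [|? ?] [|? ?] //; rewrite andbT.
(* The constancy flags in [phi'] take two values, so [bounded_agree] needs side at least 3. *)
pose m' := maxn m 3; have [M1 HM1] := IHn (I + I)%type m'.
(* The side of the grid of tails is already known from the induction, so the tails index a finite
   family of functions of the head. *)
have [M0 HM0] := tame_large nat (I * n.-tuple 'I_M1.+1)%type m'.
exists (maxn M0 M1) => phi.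
pose Fam (u : I * n.-tuple 'I_M1.+1) t := phi u.1 (t :: map val u.2).
have [|s [ss szs [kF pF]]] := HM0 Fam (iota 0 M0); first by rewrite size_iota.
pose h0 := nth 0 s.
have h0lt t : t < m' -> h0 t \in s by move=> lt_tm; rewrite mem_nth ?szs.
pose phi' (u : I + I) S := match u with inl p => phi p (h0 0 :: S)
  | inr p => (phi p (h0 0 :: S) == phi p (h0 1 :: S)) : nat end.
have [h [cls [J [hinj hM hJ]]]] := HM1 phi'.
have m'3 : 3 <= m' by rewrite leq_maxr.
have lemm' : m <= m' by rewrite leq_maxl.
have toT S : grid n M1 S -> exists tS : n.-tuple 'I_M1.+1, map val tS = S.
  case/andP=> /eqP szS /(all_nthP 0) ltS.
  exists [tuple inord (nth 0 S i) | i < n].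
  apply: (@eq_from_nth _ 0); rewrite size_map size_tuple // => i lt_in.
  rewrite (nth_map ord0) ?size_tuple // -(tnth_nth _ _ (Ordinal lt_in)) tnth_mktuple /=.
  rewrite inordK //; apply: leqW; apply: ltS; by rewrite szS.
have us : uniq s := subseq_uniq ss (iota_uniq _ _).
have key p q S S' t t' : grid n M1 S -> grid n M1 S' -> t < m' -> t' < m' ->
    (phi p (h0 t :: S) == phi q (h0 t' :: S')) =
    (phi p (h0 0 :: S) == phi q (h0 0 :: S')) &&
    ((phi p (h0 0 :: S) == phi p (h0 1 :: S)) || (t == t')).
  move=> /toT[tS eS] /toT[tS' eS'] lt_tm lt_tm'.
  have lt0 : 0 < m' by apply: leq_trans m'3.
  have lt1 : 1 < m' by apply: leq_trans m'3.
  have kp u v : phi p (h0 u :: S) = Fam (p, tS) (h0 u) by rewrite /Fam eS.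
  have kq u v : phi q (h0 u :: S') = Fam (q, tS') (h0 u) by rewrite /Fam eS'.
  have kpq u v : u < m' -> v < m' ->
      (phi p (h0 u :: S) == phi p (h0 v :: S)) =
      (phi p (h0 0 :: S) == phi p (h0 1 :: S)) || (u == v).
    move=> lt_u lt_v; have := kF (p, tS); rewrite /Fam /= eS => -[H|H].
      by rewrite (H _ _ (h0lt _ lt_u) (h0lt _ lt_v)) (H _ _ (h0lt _ lt0) (h0lt _ lt1)) !eqxx.
    by rewrite !(inj_in_eq H) ?h0lt // !nth_uniq ?szs.
  have := pF (p, tS) (q, tS'); rewrite /Fam /= eS eS' => -[H|H].
    by rewrite -!H ?h0lt // eqxx kpq.
  by rewrite !(introF eqP (H _ _ _ _)) ?h0lt.
have g0 : grid n m' (nseq n 0).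
  by rewrite /grid size_nseq eqxx all_nseq /= (leq_trans _ m'3) // orbT.
pose k p S := phi p (h0 0 :: regrid h S) == phi p (h0 1 :: regrid h S).
have kE p S : grid n m' S -> k p S = k p (nseq n 0).
  move=> gS; suff : phi' (inr p) (regrid h S) = phi' (inr p) (regrid h (nseq n 0)).
    by rewrite /= /k; do 2![case: eqP].
  apply: (@bounded_agree n m' 2 (J (inr p)) (fun S => phi' (inr p) (regrid h S))) => //.
    by move=> S1 S2 g1 g2; rewrite hJ // eqxx.
  by move=> S1 _ /=; case: eqP.
have h0M t : t < m' -> h0 t < M0.
  by move/h0lt/(mem_subseq ss); rewrite mem_iota.
exists (fun i => if i is i'.+1 then h i' else h0), (fun p => cls (inl p)),
  (fun p i => if i is i'.+1 then J (inl p) i' else ~~ k p (nseq n 0)); split.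
- case=> [_ t t' /= lt_tm lt_tm' /eqP|i lt_in].
    by rewrite nth_uniq ?szs ?(leq_trans _ lemm') // => /eqP.
  by apply: sub_in2 (hinj i lt_in) => t /leq_trans; apply.
- case=> [t _ lt_tm|i t lt_in lt_tm].
    by rewrite leq_max h0M // (leq_trans lt_tm).
  by rewrite leq_max hM ?orbT // (leq_trans lt_tm).
move=> p q [|t S] // [|t' S'] //; rewrite !grid_cons => /andP[lt_tm gS] /andP[lt_tm' gS'] /=.
have [g g'] := (grid_sub lemm' gS, grid_sub lemm' gS').
rewrite key ?(grid_regrid hM) ?(leq_trans _ lemm') //.
rewrite agree_cons -(kE p S g) implyNb.
have := hJ (inl p) (inl q) S S' g g'; rewrite /= => ->.
by rewrite -andbA; congr andb; rewrite andbC.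
Qed.

(** * The canonical partite lemma *)

Lemma sorted_ends (Q : seq nat) r : sorted ltn Q -> size Q = r.+3 -> exists f l mid,
  [/\ f \in Q, l \in Q, uniq mid, size mid = r.+1
    & {in mid, forall p, p \in Q /\ f < p < l}].
Proof.
case: Q => // f Q; elim/last_ind: Q => [|mid l _] //.
rewrite /= size_rcons rcons_path => /andP[pf lt_l] [sz].
have pw : pairwise ltn (f :: rcons mid l).
  by rewrite -sorted_pairwise /= ?rcons_path ?pf //; apply: ltn_trans.
move: pw; rewrite /= all_rcons pairwise_rcons => /andP[/andP[_ /allP fm] /andP[/allP ml pm]].
exists f, l, mid; split; rewrite ?inE ?mem_rcons ?inE ?eqxx ?orbT //.
- by apply: pairwise_uniq pm => x; rewrite /= ltnn.
- move=> p pm'; have /= lt1 := fm p pm'; have /= lt2 := ml p pm'.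
  by rewrite lt1 lt2 inE mem_rcons inE pm' !orbT.
Qed.

(* The dual of a Hales-Jewett space: Y' is a grid [M]^k, X' consists of the k M
   hyperplanes {S | S p = t}, and E' is incidence. A colouring of E' amounts to
   k colourings of the grid. A vertex x of X is sent to the
   hyperplane with value 1 at a position P x, and a vertex y of Y to a point whose
   coordinate at P x is 1 or 0 according to E x y; the remaining coordinates
   determine y. *)
Lemma canonical_partite (X Y C : finType) (E : X -> Y -> bool) :
  exists (X' Y' : finType) (E' : X' -> Y' -> bool), forall (phi : X' -> Y' -> nat)
    (tau : X' -> Y' -> C), exists (a : X -> X') (b : Y -> Y') (R1 R2 : bool),
  [/\ injective a, injective b, forall x y, E' (a x) (b y) = E x y,
      forall x y x' y', E x y -> E x' y' -> tau (a x) (b y) = tau (a x') (b y') &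
      forall x y x' y', E x y -> E x' y' ->
        (phi (a x) (b y) == phi (a x') (b y')) = (R1 ==> (x == x')) && (R2 ==> (y == y'))].
Proof.
(* The values 0 and 1 encode [E], those from 2 upwards mark the vertices of [Y]; more than [#|C|]
   values make [tau] constant by [bounded_agree]. *)
pose r := #|X|; pose m := maxn #|Y|.+2 #|C|.+1.
(* One position for each vertex of [X], the ends [f] and [l], and one that may be given up for the
   sake of [j]. *)
have [k Hk] := ramsey2 nat (bool * bool * bool * bool * C)%type r.+3.
have [M HM] := canonical_grid k.+1 ('I_k.+1 + 'I_k.+1)%type m.
exists ('I_k.+1 * 'I_M.+1)%type, {ffun 'I_k.+1 -> 'I_M.+1}, (fun x' (S : {ffun _ -> _}) => S x'.1 == x'.2).
move=> phi tau; pose conv (S : seq nat) : {ffun 'I_k.+1 -> 'I_M.+1} := [ffun i : 'I_k.+1 => inord (nth 0 S i)].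
pose phi' (u : 'I_k.+1 + 'I_k.+1) S := match u with
  | inl p => phi (p, conv S p) (conv S)
  | inr p => enum_rank (tau (p, conv S p) (conv S)) : nat end.
have [h [cls [J [hinj hM hJ]]]] := HM phi'.
have mY : #|Y|.+2 <= m by rewrite leq_maxl.
pose z := nseq k.+1 0.
have gz : grid k.+1 m z by rewrite /grid size_nseq eqxx all_nseq /= /m; lia.
pose colr p := tau (p, conv (regrid h z) p) (conv (regrid h z)).
have tauE p S : grid k.+1 m S -> tau (p, conv (regrid h S) p) (conv (regrid h S)) = colr p.
  move=> gS; apply/enum_rank_inj/ord_inj.
  apply: (@bounded_agree k.+1 m #|C| (J (inr p)) (fun S => phi' (inr p) (regrid h S))) => //.
  - by move=> S1 S2 g1 g2; rewrite hJ // eqxx.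
  - by move=> S1 _ /=.
  by rewrite /m; lia.
pose I n : 'I_k.+1 := inord n.
(* On edges at position [p] the coordinate [p] is always 1, so only dependence on other coordinates
   is visible there. *)
pose oth (p : nat) := [exists i : 'I_k.+1, (i != p :> nat) && J (inl (I p)) i].
pose chi p q :=
  (cls (inl (I p)) == cls (inl (I q)), J (inl (I p)) q, J (inl (I q)) p, oth p, colr (I p)).
have [|Q0 [c [sQ szQ pQ]]] := Hk (iota 0 k.+1) chi.
  by rewrite size_iota leqnSn.
have soQ : sorted ltn Q0 by apply: subseq_sorted sQ (iota_ltn_sorted _ _); apply: ltn_trans.
have Q0lt p : p \in Q0 -> p < k.+1 by move/(mem_subseq sQ); rewrite mem_iota.
have cP p q : p \in Q0 -> q \in Q0 -> p < q -> chi p q = c.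
  have pw : pairwise [rel p q | (chi p q == c) && (p < q)] Q0.
    by rewrite pairwise_relI pQ -sorted_pairwise //; apply: ltn_trans.
  move=> pQ0 qQ0 lt_pq; have := pairwise_neq pw pQ0 qQ0; rewrite (ltn_eqF lt_pq) => /(_ isT) /=.
  by rewrite lt_pq ltnNge (ltnW lt_pq) /= andbF orbF andbT => /eqP.
have bits p q : p \in Q0 -> q \in Q0 -> p < q ->
    [/\ (cls (inl (I p)) == cls (inl (I q))) = c.1.1.1.1, J (inl (I p)) q = c.1.1.1.2,
        J (inl (I q)) p = c.1.1.2, oth p = c.1.2 & colr (I p) = c.2].
  by move=> pQ0 qQ0 lt_pq; rewrite -(cP p q).
have [f [l [mid [fQ lQ umid szmid midP]]]] := sorted_ends soQ szQ.
(* If all positions are in one class, they have the same colour function as [f]. A coordinate on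
   which it depends, if there is one, is kept out of [Q], so that it carries the mark of [y]. *)
pose j := if c.1.1.1.1 then odflt f (omap val [pick i : 'I_k.+1 | J (inl (I f)) i]) else f.
pose Q := take r [seq p <- mid | p != j].
have szQr : size Q = r.
  rewrite size_takel // size_filter -ltnS -szmid -(count_predC (fun p => p != j)) -addn1 leq_add2l.
  by rewrite (@eq_count _ _ (pred1 j)) ?count_uniq_mem ?leq_b1 // => p /=; rewrite negbK.
have QP p : p \in Q -> [/\ p \in Q0, f < p < l, p != j & p < k.+1].
  by move/mem_take; rewrite mem_filter => /andP[-> /midP[pQ0 ->]]; rewrite pQ0 Q0lt.
have uQ : uniq Q by rewrite take_uniq // filter_uniq.
pose P (x : X) := nth 0 Q (enum_rank x).
have PQ x : P x \in Q by rewrite mem_nth // szQr ltn_ord.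
have Pinj : injective P.
  move=> x x' /eqP; rewrite nth_uniq ?szQr ?ltn_ord // => /eqP/ord_inj; exact: enum_rank_inj.
have Plt x : P x < k.+1 by have [] := QP _ (PQ x).
have IP x : I (P x) = P x :> nat by rewrite inordK.
pose s (y : Y) := mkseq (fun i => if [pick x | P x == i] is Some x then E x y : nat
  else (enum_rank y).+2) k.+1.
have sP y x : nth 0 (s y) (P x) = E x y.
  rewrite nth_mkseq //; case: pickP => [x' /eqP/Pinj->//|/(_ x)]; by rewrite eqxx.
have sN y i : i < k.+1 -> i \notin Q -> nth 0 (s y) i = (enum_rank y).+2.
  move=> lt_ik iQ; rewrite nth_mkseq //; case: pickP => // x /eqP ex.
  by rewrite -ex PQ in iQ.
have gs y : grid k.+1 m (s y).
  rewrite /grid size_mkseq eqxx; apply/(all_nthP 0); rewrite size_mkseq => i lt_ik /=.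
  rewrite nth_mkseq //; apply: leq_trans mY; case: pickP => [x _|_]; first by case: (E _ _).
  by rewrite !ltnS.
have convE S (i : 'I_k.+1) : grid k.+1 m S -> conv (regrid h S) i = inord (h i (nth 0 S i)).
  by move=> /andP[/eqP szS _]; rewrite ffunE nth_regrid ?szS.
have inordE i t t' : i < k.+1 -> t < m -> t' < m ->
    ((inord (h i t) : 'I_M.+1) == inord (h i t')) = (t == t').
  move=> lt_ik lt_tm lt_tm'.
  by rewrite -val_eqE /= !inordK ?leqW ?hM // (inj_in_eq (hinj i lt_ik)).
have m2 : 1 < m by apply: leq_trans mY.
have fl p : p \in Q -> f < p by case/QP=> _ /andP[].
pose a x := (I (P x), inord (h (P x) 1) : 'I_M.+1); pose b y := conv (regrid h (s y)).
have edge x y : E x y -> a x = (I (P x), b y (I (P x))).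
  by move=> Exy; rewrite /a /b convE // IP sP Exy.
have phiE x y : E x y -> phi (a x) (b y) = phi' (inl (I (P x))) (regrid h (s y)).
  by move=> /edge->.
have fk := Q0lt f fQ.
have fNQ : f \notin Q by apply/negP => /fl; rewrite ltnn.
have lNQ : l \notin Q by apply/negP => /QP[_ /andP[_]]; rewrite ltnn.
have jNQ : j \notin Q by apply/negP => /QP[_ _ /eqP].
pose R1 := ~~ c.1.1.1.1.
pose R2 := if c.1.1.1.1 then [exists i : 'I_k.+1, J (inl (I f)) i] else c.1.2.
exists a, b, R1, R2; split.
- move=> x x' [/(congr1 val)/=]; rewrite !IP => /Pinj //.
- move=> y y' /ffunP/(_ (I f)); rewrite /b !convE // inordK // => /eqP.
  rewrite inordE ?sN //; first by move=> /eqP[] /ord_inj/enum_rank_inj.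
    by apply: leq_trans mY; rewrite !ltnS.
  by apply: leq_trans mY; rewrite !ltnS.
- move=> x y; have Em : E x y < m by apply: leq_trans m2; case: (E x y).
  by rewrite /= /b convE // IP sP inordE //; case: (E x y).
- move=> x y x' y' Exy Exy'; rewrite (edge _ _ Exy) (edge _ _ Exy') !tauE //.
  have [[q0 /andP[_ ql] _ _] [q0' /andP[_ ql'] _ _]] := (QP _ (PQ x), QP _ (PQ x')).
  by have [_ _ _ _ ->] := bits _ _ q0 lQ ql; have [_ _ _ _ ->] := bits _ _ q0' lQ ql'.
(* Outside [Q] every coordinate holds the mark of [y], so dependence on a single one separates the
   vertices of [Y]. *)
have agreeN (D : pred nat) i y y' : i < k.+1 -> i \notin Q -> D i ->
    agree k.+1 D (s y) (s y') -> y = y'.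
  move=> lt_ik iNQ Di /allP/(_ i); rewrite mem_iota Di !sN //= => /(_ lt_ik).
  by rewrite !eqSS => /eqP/ord_inj/enum_rank_inj.
move=> x y x' y' Exy Exy'; rewrite !phiE // /R1 /R2.
have [[q0 /andP[fq ql] _ qk] [q0' /andP[fq' ql'] _ qk']] := (QP _ (PQ x), QP _ (PQ x')).
case c1: c.1.1.1.1.
  have phiF q S : q \in Q0 -> f < q -> grid k.+1 m S ->
      phi' (inl (I q)) (regrid h S) = phi' (inl (I f)) (regrid h S).
    move=> qQ0 lt_fq gS; apply/eqP; rewrite hJ // agree_refl andbT eq_sym.
    by have [-> _ _ _ _] := bits f q fQ qQ0 lt_fq; rewrite c1.
  rewrite !phiF // hJ // eqxx /=; have [->|nyy] := eqVneq y y'.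
    by rewrite agree_refl implybT.
  rewrite implybF; apply/idP/existsPn => [ag i|nJ].
    apply: contra_neqN nyy => Ji; apply: (agreeN _ j) ag => //.
      rewrite /j c1; case: pickP => [i' _|//]; exact: ltn_ord.
    by rewrite /j c1; case: pickP => [i' //|/(_ i)]; rewrite Ji.
  apply/allP => i; rewrite mem_iota => /= lt_ik; apply/implyP => Ji.
  by have := nJ (Ordinal lt_ik); rewrite /= Ji.
rewrite hJ //; have [ex|nxx] := eqVneq x x'; last first.
  have : P x != P x' by rewrite (inj_eq Pinj).
  rewrite neq_ltn => /orP[lt|gt].
    by have [-> _ _ _ _] := bits _ _ q0 q0' lt; rewrite c1.
  by rewrite eq_sym; have [-> _ _ _ _] := bits _ _ q0' q0 gt; rewrite c1.
subst x'; rewrite eqxx /=; have [->|nyy] := eqVneq y y'; first by rewrite agree_refl implybT.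
have [_ _ _ <- _] := bits _ _ q0 lQ ql.
rewrite implybF; apply/idP/existsPn => [ag i|nJ].
  apply: contra_neqN nyy => /andP[nip Ji].
  have [iQ|iNQ] := boolP ((i : nat) \in Q); last exact: (agreeN _ i) ag.
  have [i0 _ _ _] := QP _ iQ.
  (* A relevant coordinate inside [Q] is traded, by homogeneity, for the end [f] or [l] on the same
     side of [P x]. *)
  have lk := Q0lt l lQ; move: nip; rewrite neq_ltn => /orP[lt|gt].
    have [_ _ e _ _] := bits _ _ i0 q0 lt; have [_ _ e' _ _] := bits _ _ fQ q0 fq.
    by apply: (agreeN _ f) ag; rewrite // e' -e.
  have [_ e _ _ _] := bits _ _ q0 i0 gt; have [_ e' _ _ _] := bits _ _ q0 lQ ql.
  by apply: (agreeN _ l) ag; rewrite // e' -e.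
apply/allP => i; rewrite mem_iota => /= lt_ik; apply/implyP => Ji.
have := nJ (Ordinal lt_ik); rewrite /= Ji andbT negbK => /eqP->.
by rewrite !sP Exy Exy'.
Qed.

(** * Pictures *)

Lemma edgesP (V : finType) (F : graph V) (e : {set V}) :
  reflect (exists x y, F x y /\ e = [set x; y]) (e \in edges F).
Proof.
apply: (iffP imset2P) => [[x y _]|[x [y [Fxy ->]]]]; first by rewrite inE => Fxy ->; exists x, y.
by exists x y; rewrite ?inE.
Qed.

Lemma set2_eq (T : finType) (x y x' y' : T) :
  [set x; y] = [set x'; y'] -> (x = x' /\ y = y') \/ (x = y' /\ y = x').
Proof.
move=> e.
have : x \in [set x'; y'] by rewrite -e set21.
have : y \in [set x'; y'] by rewrite -e set22.
have : x' \in [set x; y] by rewrite e set21.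
have : y' \in [set x; y] by rewrite e set22.
rewrite !inE => /orP[]/eqP e1 /orP[]/eqP e2 /orP[]/eqP e3 /orP[]/eqP e4;
  subst; by [left|right].
Qed.

(** Union bound: fewer than [m] sets of density at most [1/m] do not cover. *)
Lemma avoid (I Z : finType) (B : I -> {set Z}) m :
  (forall i, #|B i| * m <= #|Z|) -> #|I| < m -> 0 < #|Z| -> exists z, forall i, z \notin B i.
Proof.
move=> Bm Im Z0; have [z zN|all_bad] := pickP [pred z | [forall i, z \notin B i]].
  by exists z; apply/forallP.
have /subset_leq_card : [set: Z] \subset \bigcup_i B i.
  apply/subsetP => z _; have /negbT := all_bad z; rewrite negb_forall => /existsP[i].
  by rewrite negbK => zi; apply/bigcupP; exists i.
rewrite cardsT => leZ.
have leU : #|\bigcup_i B i| <= \sum_i #|B i|.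
  elim/big_rec2: _ => [|i n A _ leA]; first by rewrite cards0.
  by rewrite (leq_trans (leq_card_setU _ _)) // leq_add2l.
have : #|Z| * m <= #|I| * #|Z|.
  have -> : #|I| * #|Z| = \sum_(i : I) #|Z| by rewrite sum_nat_const.
  apply: (@leq_trans (\sum_i #|B i| * m)); last exact: leq_sum.
  by rewrite -big_distrl leq_mul2r (leq_trans leZ) ?orbT.
by rewrite mulnC leq_pmul2r // leqNgt Im.
Qed.

Section Pictures.
Variables (U V : finType) (G : graph U) (F : graph V) (GG : {set {ffun V -> U}}).

(** The edges are not stored but generated by the lifts ([adjacent]), so every edge lies in a lift.
    Lifts are maps, so as to remember the labels in [V]. *)
Record picture := Picture {
  point : finType;
  proj : point -> U;
  lifts : {set {ffun V -> point}}
}.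

Implicit Type P : picture.

Definition adjacent P : rel (point P) := fun w w' =>
  [exists s in lifts P, exists x, exists y, [&& F x y, s x == w & s y == w']].

(* The second alternative closes a walk between two vertices of a lift to a cycle. *)
Definition near P : rel (point P) := fun w w' => adjacent w w' ||
  ~~ G (proj w) (proj w') && [exists s in lifts P, (w \in codom s) && (w' \in codom s)].

Definition connected_in P (S : {set point P}) : Prop :=
  forall T : {set point P}, {in S &, forall x y, x \in T -> near x y -> y \in T} ->
  {in S &, forall x y, x \in T -> y \in T}.

(* No edge of G (and no vertex) separates C; induced cycles and cliques have this
   property, and so cannot be split by an amalgamation. *)
Definition robust P (C : {set point P}) : Prop := forall i j, (i == j) || G i j ->
  connected_in [set w in C | (proj w != i) && (proj w != j)].

Definition clean_lifts P : Prop := {in lifts P &, forall s t : {ffun V -> point P}, s != t ->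
  (forall v v', s v \in codom t -> s v' \in codom t -> v = v') \/
  (exists x y, [/\ F x y, s x \in codom t, s y \in codom t &
     forall v, s v \in codom t -> (v == x) || (v == y)])}.

(** The initial picture maps to [F] by its labels; amalgamation preserves this only on sets that it
    cannot split. The second clause pins the ends of a path that starts and ends in one lift. Pairs
    joined in [G] are exempt, since different copies of a picture may share such a pair under
    different labels. *)
Definition folds P : Prop := forall C : {set point P}, 2 < #|C| ->
  {in C &, injective (@proj P)} -> robust C ->
  exists eta : point P -> V, {in C &, forall w w', adjacent w w' -> F (eta w) (eta w')} /\
    {in lifts P, forall (s : {ffun V -> point P}) v v', s v \in C -> s v' \in C -> v != v' ->
      ~~ G (proj (s v)) (proj (s v')) -> eta (s v) = v}.

(** Cleanness is conditional because the copies of [F] in the first, complete [G] are in general not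
    induced. *)
Record sound P : Prop := Sound {
  sound_point : inhabited (point P);
  sound_proj : {in lifts P, forall s : {ffun V -> point P}, [ffun v => proj (s v)] \in GG};
  sound_induced : {in lifts P, forall (s : {ffun V -> point P}) x y, adjacent (s x) (s y) -> F x y};
  sound_clean : {in GG, forall (g : {ffun V -> U}) x y, G (g x) (g y) -> F x y} -> clean_lifts P;
  sound_folds : folds P
}.

(** One [psi] serves all copies, because the canonical copy in [G] is chosen only after [psi] is
    known. *)
Definition transfers P (phi : {set point P} -> nat) : Prop :=
  exists psi : {set U} -> nat, {in GG, forall g : {ffun V -> U},
    exists2 s : {ffun V -> point P}, s \in lifts P &
    (forall v, proj (s v) = g v) /\ {in edges F &, forall e e' : {set V},
      (phi (s @: e) == phi (s @: e')) = (psi (g @: e) == psi (g @: e'))}}.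

Definition trace P (A : {set U}) (b : {set point P}) := [set w in b | proj w \in A].

(** The equality of cardinals encodes that the projection is injective on [r]. *)
Definition section_over P (A : {set U}) (r : {set point P}) :=
  (@proj P @: r == A) && (#|@proj P @: r| == #|r|).

Definition edge_over P (e : {set U}) (b : {set point P}) : Prop :=
  exists w w', [/\ adjacent w w', b = [set w; w'] & [set proj w; proj w'] = e].

Section Decided.
Variables (P : picture) (phi : {set point P} -> nat).
Variables (R : {set U} -> {set U}) (f : {set U} -> {set point P} -> nat).

(* To be used with e decided before e': in the first case agreement is rare, in
   the second the colours always agree, in the third they never do. *)
Definition compatible (e e' : {set U}) : Prop := [\/ ~~ (R e \subset e'),
  R e = R e' /\ (forall r : {set point P}, section_over (R e) r -> f e r = f e' r) |
  [/\ R e \subset e', forall b : {set point P}, edge_over e' b -> phi b <> f e (trace (R e) b) &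
      R e = R e' -> forall r : {set point P}, section_over (R e) r -> f e r <> f e' r]].

(* R e is the root of e, and the colour of an edge over e is a function of its part
   over the root. For R e = e only the values f e on edges of P matter. *)
Record decides (D : {set {set U}}) : Prop := Decides {
  root_sub : {in D, forall e, R e \subset e};
  root_colour : {in D, forall (e : {set U}) b, edge_over e b -> phi b = f e (trace (R e) b)};
  root_inj : {in D, forall (e : {set U}) b b', edge_over e b -> edge_over e b' -> phi b = phi b' ->
    trace (R e) b = trace (R e) b'};
  root_inj_section : {in D, forall (e : {set U}) r r', R e != e -> section_over (R e) r ->
    section_over (R e) r' -> f e r = f e r' -> r = r'};
  root_compatible : {in D &, forall e e' : {set U}, e != e' -> compatible e e' \/ compatible e' e}
}.
End Decided.

Hypothesis GG_inj : {in GG, forall g : {ffun V -> U}, injective g}.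

Lemma adjacentP P w w' : reflect (exists s x y, [/\ s \in lifts P, F x y, s x = w & s y = w'])
  (@adjacent P w w').
Proof.
apply: (iffP exists_inP) => [[s sL /existsP[x /existsP[y /and3P[Fxy /eqP<- /eqP<-]]]]|].
  by exists s, x, y.
move=> [s [x [y [sL Fxy <- <-]]]]; exists s => //.
by apply/existsP; exists x; apply/existsP; exists y; rewrite Fxy !eqxx.
Qed.

Lemma adjacent_lift P s x y : s \in lifts P -> F x y -> adjacent (s x) (s y).
Proof. by move=> sL Fxy; apply/adjacentP; exists s, x, y. Qed.

Lemma adjacent_sym P : symmetric (@adjacent P).
Proof.
by move=> w w'; apply/adjacentP/adjacentP => -[s [x [y [sL Fxy <- <-]]]];
  exists s, y, x; rewrite adj_sym.
Qed.

Lemma near_sym P : symmetric (@near P).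
Proof.
move=> w w'; rewrite /near adjacent_sym adj_sym; congr (_ || _ && _).
by apply: eq_existsb => s; rewrite [(w \in _) && _]andbC.
Qed.

(** * The initial picture *)

Section Initial.
Variable d : nat.

Definition coord := {ffun {set V} -> 'I_d.+1}.

(* The vertex v of the lift z forgets the coordinates at the edges through v. So two
   lifts share the edge e if and only if they differ in the coordinate e only. *)
Definition mask (v : V) (z : coord) : coord :=
  [ffun e => if (e \in edges F) && (v \notin e) then z e else ord0].

Definition lift0 (g : {ffun V -> U}) (z : coord) :
  {ffun V -> {ffun V -> U} * V * coord} := [ffun v => (g, v, mask v z)].

Definition picture0 : picture := @Picture ({ffun V -> U} * V * coord)%type
  (fun w => w.1.1 w.1.2) [set lift0 p.1 p.2 | p in [set q : {ffun V -> U} * coord | q.1 \in GG]].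

Lemma lifts0P s : reflect (exists g z, g \in GG /\ s = lift0 g z) (s \in lifts picture0).
Proof.
apply: (iffP imsetP) => [[[g z]]|[g [z [gG ->]]]].
  by rewrite inE /= => gG ->; exists g, z.
by exists (g, z); rewrite ?inE.
Qed.

(** Lifts of different copies are disjoint. Different lifts of one copy disagree in a coordinate
    [e], which only the vertices of [e] forget. The folding map is the label. *)
Lemma sound0 g (v : V) : g \in GG -> sound picture0.
Proof.
move=> gG; split.
- by split; exact: (g, v, [ffun=> ord0]).
- move=> s /lifts0P[g' [z [g'G ->]]].
  by rewrite (_ : [ffun _ => _] = g') //; apply/ffunP => w; rewrite !ffunE.
- move=> s /lifts0P[g' [z [g'G ->]]] x y /adjacentP[t [x' [y' [/lifts0P[h [z' [_ ->]]]]]]].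
  by rewrite !ffunE => Fxy [_ <- _] [_ <- _].
- move=> _ s t /lifts0P[g1 [z1 [g1G ->]]] /lifts0P[g2 [z2 [g2G ->]]] nst.
  case: (eqVneq g1 g2) => [eg|neg]; last first.
    by left=> u u' /codomP[w]; rewrite !ffunE => -[/eqP]; rewrite (negbTE neg).
  subst g2.
  have mE u : lift0 g1 z1 u \in codom (lift0 g1 z2) -> mask u z1 = mask u z2.
    by case/codomP=> w; rewrite !ffunE => -[<-].
  have [e eF ne] : exists2 e, e \in edges F & z1 e != z2 e.
    apply/exists_inP; apply: contraR nst => /exists_inPn em; apply/eqP/ffunP => w.
    rewrite !ffunE; congr (_, _, _); apply/ffunP => e; rewrite !ffunE.
    by case: ifP => // /andP[/em]; rewrite negbK => /eqP.
  have mem_e u : lift0 g1 z1 u \in codom (lift0 g1 z2) -> u \in e.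
    move/mE/ffunP/(_ e); rewrite !ffunE eF /=; case: (u \in e) => // /eqP.
    by rewrite (negbTE ne).
  case/edgesP: eF => a [b [Fab ee]].
  have mem_ab u : lift0 g1 z1 u \in codom (lift0 g1 z2) -> (u == a) || (u == b).
    by move/mem_e; rewrite ee !inE.
  have [aI|aN] := boolP (lift0 g1 z1 a \in codom (lift0 g1 z2)); last first.
    left=> u u' uI u'I; have := mem_ab u uI; have := mem_ab u' u'I.
    by case/pred2P=> e1; case/pred2P=> e2; subst => //; rewrite ?uI ?u'I in aN.
  have [bI|bN] := boolP (lift0 g1 z1 b \in codom (lift0 g1 z2)); last first.
    left=> u u' uI u'I; have := mem_ab u uI; have := mem_ab u' u'I.
    by case/pred2P=> e1; case/pred2P=> e2; subst => //; rewrite ?uI ?u'I in bN.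
  by right; exists a, b.
move=> C _ _ _; exists (fun w => w.1.2); split.
  by move=> w w' _ _ /adjacentP[t [x' [y' [/lifts0P[h [z' [_ ->]]]]]]] Fxy <- <-; rewrite !ffunE.
by move=> s /lifts0P[g' [z [_ ->]]] x y _ _ _ _; rewrite ffunE.
Qed.

(** Each pair of edges spoils a share of at most [1/(d+1)] of the lifts, so the union bound leaves a
    lift spoilt by no pair. *)
Hypothesis d_large : #|{: {set V} * {set V}}| <= d.

Lemma edge_over_lift P (g : {ffun V -> U}) (s : {ffun V -> point P}) (e : {set V}) : g \in GG -> s \in lifts P ->
  (forall v, proj (s v) = g v) -> e \in edges F -> edge_over (g @: e) (s @: e).
Proof.
move=> gG sL sg /edgesP[x [y [Fxy ->]]]; rewrite !imsetU !imset_set1.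
by exists (s x), (s y); rewrite !sg adjacent_lift.
Qed.

Lemma trace_liftP P (g : V -> U) (s : {ffun V -> point P}) (A : {set U}) (e : {set V}) w :
  (forall v, proj (s v) = g v) ->
  reflect (exists v, [/\ v \in e, g v \in A & w = s v]) (w \in trace A (s @: e)).
Proof.
move=> sg; rewrite inE; apply: (iffP andP) => [[/imsetP[v ve ->]]|[v [ve gA ->]]].
  by rewrite sg => gA; exists v.
by rewrite sg imset_f.
Qed.

Lemma section_trace P (g : {ffun V -> U}) (s : {ffun V -> point P}) (A : {set U}) (e : {set V}) : g \in GG ->
  (forall v, proj (s v) = g v) -> A \subset g @: e -> section_over A (trace A (s @: e)).
Proof.
move=> gG sg /subsetP sA; apply/andP; split.
  apply/eqP/setP => k; apply/imsetP/idP => [[w]|kA].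
    by case/(trace_liftP _ _ _ sg) => v [_ gvA ->] ->; rewrite sg.
  have /imsetP[v ve ek] := sA k kA; exists (s v); rewrite ?sg //.
  by apply/(trace_liftP _ _ _ sg); exists v; rewrite -ek.
apply/imset_injP => w w' /(trace_liftP _ _ _ sg)[v [_ _ ->]] /(trace_liftP _ _ _ sg)[v' [_ _ ->]].
by rewrite !sg => /(GG_inj gG)->.
Qed.

Lemma eq_trace P (g : {ffun V -> U}) (s : {ffun V -> point P}) (A : {set U}) (e e' : {set V}) : g \in GG ->
  (forall v, proj (s v) = g v) -> A \subset g @: e -> A \subset g @: e' ->
  trace A (s @: e) = trace A (s @: e').
Proof.
move=> gG sg /subsetP sA /subsetP sA'; apply/setP => w.
by apply/(trace_liftP _ _ _ sg)/(trace_liftP _ _ _ sg) => -[v [ve gA ->]]; exists v; split=> //;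
  [have /imsetP[v' v'e /(GG_inj gG)->] := sA' _ gA|have /imsetP[v' v'e /(GG_inj gG)->] := sA _ gA].
Qed.

Section Transfer0.
Variables (phi : {set point picture0} -> nat).
Variables (R : {set U} -> {set U}) (f : {set U} -> {set point picture0} -> nat).
Hypothesis dec : decides phi R f (edges G).
Hypothesis GG_hom : {in GG, forall (g : {ffun V -> U}) x y, F x y -> G (g x) (g y)}.

Lemma proj_lift0 g z v : @proj picture0 (lift0 g z v) = g v.
Proof. by rewrite /= ffunE. Qed.

Lemma mem_lift0 g z : g \in GG -> lift0 g z \in lifts picture0.
Proof. by move=> gG; apply/lifts0P; exists g, z. Qed.

Lemma edge_image (g : {ffun V -> U}) (e : {set V}) : g \in GG -> e \in edges F -> g @: e \in edges G.
Proof.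
move=> gG /edgesP[x [y [Fxy ->]]]; apply/edgesP; exists (g x), (g y).
by rewrite imsetU !imset_set1 GG_hom.
Qed.

Lemma edge_over0 (g : {ffun V -> U}) z (e : {set V}) : g \in GG -> e \in edges F ->
  edge_over (g @: e) (lift0 g z @: e : {set point picture0}).
Proof.
move=> gG eF; apply: edge_over_lift => //; [exact: mem_lift0|exact: proj_lift0].
Qed.

(* Along each line in direction [e'] the edge over [e'] stays put, while the
   trace of the edge over [e] on its root moves. *)
Lemma few_conflicts (g : {ffun V -> U}) (e e' : {set V}) : g \in GG -> e \in edges F -> e' \in edges F ->
  ~~ (R (g @: e) \subset g @: e') ->
  #|[set z | phi (lift0 g z @: e) == phi (lift0 g z @: e')]| * d.+1 <= #|{: coord}|.
Proof.
move=> gG eF e'F nsub; set B := [set z | _].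
pose upd (p : coord * 'I_d.+1) : coord := [ffun e2 => if e2 == e' then p.2 else p.1 e2].
suff inj : {in setX B [set: 'I_d.+1] &, injective upd}.
  have := card_in_imset inj; rewrite cardsX cardsT card_ord => <-; exact: max_card.
move=> [z t] [z' t'] /setXP[/= zB _] /setXP[/= z'B _] /ffunP eu.
have -> : t = t' by have := eu e'; rewrite !ffunE eqxx.
have eu' e2 : e2 != e' -> z e2 = z' e2 by have := eu e2; rewrite !ffunE; case: eqP.
suff ez : z e' = z' e'.
  by congr (_, _); apply/ffunP => e2; have [->|/eu'] := eqVneq e2 e'.
have eqe' : lift0 g z @: e' = lift0 g z' @: e'.
  apply: eq_in_imset => v ve; rewrite !ffunE; congr (_, _, _); apply/ffunP => e2.
  by rewrite !ffunE; case: ifP => // /andP[_ ve2]; apply: eu'; apply: contraNneq ve2 => ->.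
move: zB z'B; rewrite !inE eqe' => /eqP <- /eqP ephi.
have gE := edge_image gG eF.
have := root_inj dec gE (edge_over0 z gG eF) (edge_over0 z' gG eF) (esym ephi).
case/subsetPn: nsub => k kR kN.
have /imsetP[v ve ek] := subsetP (root_sub dec gE) k kR.
have pz z0 u : @proj picture0 (lift0 g z0 u) = g u := proj_lift0 g z0 u.
move/setP/(_ (lift0 g z v)) => e1.
have : lift0 g z v \in trace (R (g @: e)) (lift0 g z @: e : {set point picture0}).
  by apply/(trace_liftP _ _ _ (pz z)); exists v; rewrite -ek.
rewrite e1 => /(trace_liftP _ _ _ (pz z'))[u [_ _]]; rewrite !ffunE => -[<- /ffunP/(_ e')].
rewrite !ffunE e'F /=; case: (boolP (v \in e')) => //= ve'.
by case/negP: kN; rewrite ek imset_f.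
Qed.

(** If the root of one edge is not inside the other, the lift is chosen to avoid agreement, and
    [psi] separates the two since their roots differ. In the other cases of [compatible] the colours
    always or never agree, and so do the values of [psi]. *)
Lemma transfers0 : transfers phi.
Proof.
(* [cut] erases the values off sections, on which [compatible] is silent, and leaves a finite object
   that [pickle] turns into a number. *)
pose cut A (h : {set point picture0} -> nat) : {ffun {set point picture0} -> nat} :=
  [ffun r => if section_over A r then h r else 0].
pose psi e := pickle (R e, cut (R e) (f e)).
exists psi => g gG.
pose B (p : {set V} * {set V}) : {set coord} :=
  if [&& p.1 \in edges F, p.2 \in edges F & ~~ (R (g @: p.1) \subset g @: p.2)] then
  [set z | phi (lift0 g z @: p.1) == phi (lift0 g z @: p.2)] else set0.
have [|||z zB] := @avoid _ _ B d.+1.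
- move=> p; rewrite /B; case: ifP => [/and3P[*]|_]; last by rewrite cards0.
  exact: few_conflicts.
- by rewrite ltnS.
- by apply/card_gt0P; exists [ffun=> ord0].
exists (lift0 g z); first exact: mem_lift0.
split=> [|e e' eF e'F]; first exact: proj_lift0.
have [->|nee] := eqVneq e e'; first by rewrite !eqxx.
have nge : g @: e != g @: e' by rewrite (inj_eq (imset_inj (GG_inj gG))).
have [gE gE'] := (edge_image gG eF, edge_image gG e'F).
wlog cmp : e e' eF e'F nee nge gE gE' / compatible phi R f (g @: e) (g @: e').
  move=> H; case: (root_compatible dec gE gE' nge) => cmp; first exact: H.
  by rewrite eq_sym [RHS]eq_sym; apply: H; rewrite // eq_sym.
have sE := root_sub dec gE; have sE' := root_sub dec gE'.
have pz := proj_lift0 g z.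
have phiE := root_colour dec gE (edge_over0 z gG eF).
have phiE' := root_colour dec gE' (edge_over0 z gG e'F).
have sec := section_trace gG pz sE.
have psiE (a b : {set U}) : psi a = psi b -> R a = R b /\ cut (R a) (f a) = cut (R b) (f b).
  by move/(pcan_inj pickleK) => [].
case: cmp => [nsub|[eR ef]|[sub nphi nf]].
- transitivity false.
    apply/negbTE; have := zB (e, e'); rewrite /B /= eF e'F nsub inE //.
  by apply/esym/eqP => /psiE[eR _]; rewrite eR sE' in nsub.
- transitivity true.
    have sub : R (g @: e) \subset g @: e' by rewrite eR.
    by rewrite phiE phiE' -eR -ef -(eq_trace gG pz sE sub) ?eqxx.
  apply/esym/eqP; rewrite /psi eR; congr (pickle (_, _)); apply/ffunP => r.
  by rewrite !ffunE; case: ifP => // sr; rewrite -ef // eR.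
transitivity false.
  apply/eqP; rewrite phiE (eq_trace gG pz sE sub) => /esym.
  exact/nphi/edge_over0.
apply/esym/eqP => /psiE[eR /ffunP ecut]; have := nf eR _ sec.
by have := ecut (trace (R (g @: e)) (lift0 g z @: e : {set point picture0}));
  rewrite !ffunE -eR sec.
Qed.
End Transfer0.
End Initial.
End Pictures.

(** * Amalgamation along an edge *)

Section Amalgamation.
Variables (U V : finType) (G : graph U) (F : graph V) (GG : {set {ffun V -> U}}).
Hypothesis GG_inj : {in GG, forall g : {ffun V -> U}, injective g}.
Hypothesis GG_hom : {in GG, forall (g : {ffun V -> U}) x y, F x y -> G (g x) (g y)}.

Lemma sound_inj P s : sound G F GG P -> s \in lifts P -> injective s.
Proof.
move=> sP /(sound_proj sP)/GG_inj gi v v' e; apply: gi.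
by rewrite !ffunE e.
Qed.

Lemma adjacent_proj (P : picture U V) w w' : sound G F GG P ->
  adjacent F w w' -> G (@proj _ _ P w) (proj w').
Proof.
move=> sP /adjacentP[s [x [y [sL Fxy <- <-]]]].
by have := GG_hom (sound_proj sP sL) Fxy; rewrite !ffunE.
Qed.

Variables (P : picture U V) (i j : U) (X' Y' : finType) (E' : X' -> Y' -> bool).
Hypotheses (sP : sound G F GG P) (Gij : G i j).

(* The edges over {i, j}, where [None] adds on either side a vertex joined to
   everything on the other side. *)
Definition edge_ij (x y : option (point P)) : bool :=
  match x, y with
  | Some a, Some b => [&& proj a == i, proj b == j & adjacent F a b]
  | _, _ => true
  end.

(** Embeddings are induced, so that the copies of [P] acquire no further edges. *)
Definition is_emb (l : {ffun option (point P) -> X'} * {ffun option (point P) -> Y'}) : bool :=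
  [&& injectiveb l.1, injectiveb l.2 &
      [forall x, forall y, E' (l.1 x) (l.2 y) == edge_ij x y]].

Definition embedding := {l | is_emb l}.

(** Copies of [P], one for each embedding, glued along [X'] over [i] and [Y'] over [j]. *)
Definition amalgam_point : finType := (X' + Y' + embedding * point P)%type.

Definition amalgam_proj (w : amalgam_point) : U :=
  match w with inl (inl _) => i | inl (inr _) => j | inr p => proj p.2 end.

Definition embed (l : embedding) (w : point P) : amalgam_point :=
  if proj w == i then inl (inl ((val l).1 (Some w)))
  else if proj w == j then inl (inr ((val l).2 (Some w))) else inr (l, w).

Definition amalgam : picture U V := @Picture _ _ amalgam_point amalgam_proj
  [set [ffun v => embed p.1 ((p.2 : {ffun V -> point P}) v)] |
     p in [set q : embedding * {ffun V -> point P} | q.2 \in lifts P]].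

Lemma embP (l : embedding) :
  [/\ injective (val l).1, injective (val l).2 & forall x y, E' ((val l).1 x) ((val l).2 y) = edge_ij x y].
Proof.
case: l => l /= /and3P[/injectiveP i1 /injectiveP i2 /forallP e]; split=> // x y.
by apply/eqP; have /forallP := e x.
Qed.

Lemma neq_ij : i != j.
Proof. by apply: contraTneq Gij => ->; rewrite adj_irr. Qed.

Lemma proj_embed l w : @proj _ _ amalgam (embed l w) = proj w.
Proof. by rewrite /embed; case: eqP => //= _; case: eqP. Qed.

Lemma embed_inj l : injective (embed l).
Proof.
have [i1 i2 _] := embP l; move=> w w' e.
have ep : proj w = proj w' by rewrite -!(proj_embed l) e.
move: e; rewrite /embed -ep; case: eqP => _; first by move=> [] /i1[].
by case: eqP => _ [] // /i2[].
Qed.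

Lemma embed_inner l l' w w' : proj w != i -> proj w != j -> embed l w = embed l' w' -> l = l'.
Proof.
move=> ni nj e; have ep : proj w = proj w' by rewrite -(proj_embed l) e proj_embed.
by move: e; rewrite /embed -ep (negbTE ni) (negbTE nj) => -[].
Qed.

Lemma amalgam_liftsP s :
  reflect (exists l t, t \in lifts P /\ s = [ffun v => embed l (t v)]) (s \in lifts amalgam).
Proof.
apply: (iffP imsetP) => [[[l t]]|[l [t [tL ->]]]].
  by rewrite inE /= => tL ->; exists l, t.
by exists (l, t); rewrite ?inE.
Qed.

Lemma lift_embed l s : s \in lifts P -> [ffun v => embed l (s v)] \in lifts amalgam.
Proof. by move=> sL; apply/amalgam_liftsP; exists l, s. Qed.

Lemma amalgam_adjacentP w w' : reflect
  (exists l a b, [/\ adjacent F a b, w = embed l a & w' = embed l b]) (@adjacent _ _ F amalgam w w').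
Proof.
apply: (iffP (adjacentP _ _ _)) => [[s [x [y [/amalgam_liftsP[l [t [tL ->]]] Fxy <- <-]]]]|].
  by exists l, (t x), (t y); rewrite !ffunE adjacent_lift.
move=> [l [a [b [/adjacentP[t [x [y [tL Fxy <- <-]]]] -> ->]]]].
by exists [ffun v => embed l (t v)], x, y; rewrite !ffunE lift_embed.
Qed.

(** An edge that another copy contributes between two points of this one has its ends over [i] and
    [j]. So it is an edge of [E'], and of [P] because the embedding is induced. *)
Lemma adjacent_embed l a b : @adjacent _ _ F amalgam (embed l a) (embed l b) = adjacent F a b.
Proof.
apply/amalgam_adjacentP/idP => [[l' [a' [b' [ab ea eb]]]]|ab]; last by exists l, a, b.
have [pa pb] : proj a = proj a' /\ proj b = proj b'.
  by rewrite -(proj_embed l) ea -(proj_embed l b) eb !proj_embed.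
case: (eqVneq l l') ea eb => [<- /embed_inj-> /embed_inj-> //|nl ea eb].
have Gab := adjacent_proj sP ab.
have in_ij w w' : embed l w = embed l' w' -> (proj w == i) || (proj w == j).
  by move=> e; apply: contraNT nl; rewrite negb_or => /andP[ni nj]; rewrite (embed_inner ni nj e).
have [_ _ El] := embP l; have [_ _ El'] := embP l'.
have key c c' e e' : adjacent F c' e' -> proj c = i -> proj e = j -> embed l c = embed l' c' ->
    embed l e = embed l' e' -> adjacent F c e.
  move=> ce pc pe ec ee; have pc' : proj c' = i by rewrite -(proj_embed l') -ec proj_embed.
  have pe' : proj e' = j by rewrite -(proj_embed l') -ee proj_embed.
  have := El (Some c) (Some e); rewrite /= pc pe !eqxx /= => <-.
  have := El' (Some c') (Some e'); rewrite /= pc' pe' !eqxx ce /= => E2.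
  move: ec ee; rewrite /embed pc pc' pe pe' eqxx (eq_sym j) (negbTE neq_ij) eqxx.
  by move=> [->] [->]; rewrite E2.
case/orP: (in_ij _ _ ea) => /eqP pi; case/orP: (in_ij _ _ eb) => /eqP pj.
- by move: Gab; rewrite -pa -pb pi pj adj_irr.
- exact: key ab _ _ ea eb.
- by rewrite adjacent_sym; rewrite adjacent_sym in ab; apply: key ab _ _ eb ea.
- by move: Gab; rewrite -pa -pb pi pj adj_irr.
Qed.

(** Two copies of [P] share only points over [i] and [j], and a lift has at most one of each. If it
    has both, inducedness turns [G i j] into an edge of [F]. *)
Lemma clean_amalgam : {in GG, forall (g : {ffun V -> U}) x y, G (g x) (g y) -> F x y} ->
  clean_lifts F amalgam.
Proof.
move=> ind s1 s2 /amalgam_liftsP[l1 [s [sL ->]]] /amalgam_liftsP[l2 [t [tL ->]]] nst.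
have gG := sound_proj sP sL; have gi := GG_inj gG.
set s1' := finfun _; set s2' := finfun _.
have [el|nl] := eqVneq l1 l2.
  have mE v : (s1' v \in codom s2') = (s v \in codom t).
    apply/codomP/codomP => -[w]; rewrite !ffunE; last by move->; exists w; rewrite ffunE el.
    by rewrite el => /embed_inj->; exists w.
  have nst' : s != t by apply: contraNneq nst => ->; rewrite /s1' /s2' el.
  case: (sound_clean sP ind sL tL nst') => [H|[x [y [Fxy xI yI H]]]].
    by left=> v v'; rewrite !mE; apply: H.
  by right; exists x, y; rewrite !mE; split=> // v; rewrite mE; apply: H.
have in_ij v : s1' v \in codom s2' -> (proj (s v) == i) || (proj (s v) == j).
  case/codomP=> w; rewrite !ffunE => e; apply: contraNT nl; rewrite negb_or => /andP[ni nj].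
  by rewrite (embed_inner ni nj e).
have gE v v' : proj (s v) = proj (s v') -> v = v' by move=> e; apply: gi; rewrite !ffunE.
have [/existsP[v /existsP[v' /and3P[vI v'I nvv]]]|no] :=
    boolP [exists v, exists v', [&& s1' v \in codom s2', s1' v' \in codom s2' & v != v']].
  right; exists v, v'; split=> //.
    apply: ind gG _ _ _; rewrite !ffunE.
    have : proj (s v) != proj (s v') by apply: contraNneq nvv => /gE ->.
    by case/pred2P: (in_ij _ vI) => ->; case/pred2P: (in_ij _ v'I) => ->; rewrite ?eqxx // adj_sym.
  move=> v2 /in_ij; have := in_ij _ vI; have := in_ij _ v'I => h1 h2 h3.
  apply: contraT => /norP[n1 n2].
  suff : [|| v == v', v2 == v | v2 == v'] by rewrite (negbTE nvv) (negbTE n1) (negbTE n2).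
  case/pred2P: h1 => e1; case/pred2P: h2 => e2; case/pred2P: h3 => e3; apply/or3P;
    by [constructor 1; apply/eqP/gE; congruence | constructor 2; apply/eqP/gE; congruence
       | constructor 3; apply/eqP/gE; congruence].
left=> v v' vI v'I; apply/eqP; apply: contraNT no => nvv.
by apply/existsP; exists v; apply/existsP; exists v'; rewrite vI v'I.
Qed.

Lemma embed_distinct l l' w w' u u' : l != l' -> embed l w = embed l' w' -> embed l u = embed l' u' ->
  proj w != proj u -> G (proj w) (proj u).
Proof.
move=> nl ew eu npu.
have in_ij x x' : embed l x = embed l' x' -> (proj x == i) || (proj x == j).
  by move=> e; apply: contraNT nl; rewrite negb_or => /andP[ni nj]; rewrite (embed_inner ni nj e).
move: npu; case/pred2P: (in_ij _ _ ew) => ->; case/pred2P: (in_ij _ _ eu) => ->;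
  by rewrite ?eqxx // adj_sym.
Qed.

Lemma near_embed l a b : proj a != proj b ->
  near G F (embed l a : point amalgam) (embed l b) -> near G F a b.
Proof.
move=> nab; rewrite /near adjacent_embed !proj_embed => /orP[->//|/andP[nG]].
case/exists_inP=> _ /amalgam_liftsP[l' [t [tL ->]]] /andP[/codomP[v]].
rewrite ffunE => ea /codomP[v']; rewrite ffunE => eb.
have [el|nl] := eqVneq l l'; last by rewrite (embed_distinct nl ea eb nab) in nG.
subst l'; rewrite (embed_inj ea) (embed_inj eb) in nG *; rewrite nG orbC.
by apply/orP; left; apply/exists_inP; exists t; rewrite ?codom_f.
Qed.

(** Having more than two points, [C] contains one away from [i] and [j], which belongs to a single
    copy [l]. As points over [i] and [j] do not separate [C], all of [C] lies in this copy, and [P]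
    folds it. *)
Lemma folds_amalgam : folds G F amalgam.
Proof.
move=> C C3 Ci Cr.
pose in_ij (w : point amalgam) := (proj w == i) || (proj w == j).
have [a aC na] : exists2 a, a \in C & ~~ in_ij a.
  apply/exists_inP; apply: contraLR C3 => /exists_inPn Cij; rewrite -leqNgt.
  rewrite -(card_in_imset Ci); apply: (@leq_trans #|[set i; j]|); last by rewrite cards2; case: (i != j).
  by apply/subset_leq_card/subsetP => u /imsetP[w /Cij wij ->]; rewrite negbK in wij; rewrite !inE.
have [l [w0 ea]] : exists l w0, a = embed l w0.
  move: (a) na; case=> [[x|y]|[l w0]]; rewrite /in_ij /= ?eqxx ?orbT // => /norP[ni nj].
  by exists l, w0; rewrite /embed (negbTE ni) (negbTE nj).
pose I : {set point amalgam} := [set w in codom (embed l)].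
have inner x y : x \in I -> ~~ in_ij x -> near G F x y -> y \in I.
  rewrite !inE => /codomP[x0 ->]; rewrite /in_ij proj_embed => /norP[ni nj].
  case/orP=> [/amalgam_adjacentP[l' [a' [b' [_ e ->]]]]|/andP[_ /exists_inP[_ /amalgam_liftsP[l' [t [tL ->]]]]]].
    by rewrite (embed_inner ni nj e) codom_f.
  case/andP=> /codomP[v]; rewrite ffunE => e /codomP[v' ->]; rewrite ffunE.
  by rewrite (embed_inner ni nj e) codom_f.
have aI : a \in I by rewrite inE ea codom_f.
have I3 b : b \in C -> ~~ in_ij b -> b \in I.
  move=> bC nb; have Gij' : (i == j) || G i j by rewrite Gij orbT.
  apply: (Cr i j Gij' I _ a b) => //; try by rewrite inE ?aC ?bC -negb_or.
  by move=> x y /setIdP[xC]; rewrite -negb_or => nx _ xI; apply: inner.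
(* A point over [k] is reached by removing only the one over [k'], that is, by robustness for the
   pair [k'], [k']. *)
have I4k k k' b : (forall w, in_ij w = (proj w == k) || (proj w == k')) -> k != k' ->
    b \in C -> proj b = k -> b \in I.
  move=> ijE nk bC bk; have kk : (k' == k') || G k' k' by rewrite eqxx.
  apply: (Cr k' k' kk I _ a b) => //; last 2 first.
  - by rewrite inE aC; move: na; rewrite ijE => /norP[_ ->].
  - by rewrite inE bC bk nk.
  move=> x y /setIdP[xC]; rewrite andbb => nx /setIdP[yC]; rewrite andbb => ny xI xy.
  have [yij|] := boolP (in_ij y); last exact: I3.
  have [xij|nxij] := boolP (in_ij x); last exact: inner xy.
  rewrite (_ : y = x) //; apply: Ci => //; move: xij yij; rewrite !ijE (negbTE nx) (negbTE ny) !orbF.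
  by move=> /eqP-> /eqP->.
have I4 b : b \in C -> b \in I.
  move=> bC; have [bij|] := boolP (in_ij b); last exact: I3.
  case/pred2P: bij => e; first exact: (I4k i j) neq_ij bC e.
  by apply: (I4k j i) bC e; [move=> w; rewrite orbC|rewrite eq_sym neq_ij].
have {I4 I4k I3 inner aI} CE b : b \in C -> exists b0, b = embed l b0.
  by move/I4; rewrite inE => /codomP.
pose C0 := [set w | embed l w \in C].
have CC0 : C = embed l @: C0.
  apply/setP => b; apply/idP/imsetP => [bC|[b0]]; last by rewrite inE => ? ->.
  by have [b0 eb] := CE b bC; exists b0; rewrite // inE -eb.
have Ci0 : {in C0 &, injective (@proj _ _ P)}.
  move=> x y; rewrite !inE => xC yC e; apply: (@embed_inj l); apply: Ci => //.
  by rewrite !proj_embed.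
have [||eta0 [eta_hom eta_lift]] := sound_folds sP _ Ci0.
- by rewrite CC0 card_imset in C3; last exact: embed_inj.
- move=> i0 j0 ij0 T0 T0c x y; rewrite !inE => /andP[xC nx] /andP[yC ny] xT.
  have : embed l y \in (embed l @: T0 : {set point amalgam}).
    apply: (Cr i0 j0 ij0 _ _ (embed l x)); rewrite ?inE ?proj_embed ?xC ?yC ?imset_f //.
    move=> x1 y1; rewrite !inE => /andP[x1C nx1] /andP[y1C ny1] /imsetP[x2 x2T ex] xy.
    have [y2 ey] := CE _ y1C; rewrite ex ey in xy *.
    rewrite ex proj_embed in nx1 x1C; rewrite ey proj_embed in ny1 y1C.
    have [e|ne] := eqVneq (proj x2) (proj y2).
      by rewrite -(Ci0 x2 y2 _ _ e) ?imset_f ?inE.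
    apply: imset_f; apply: T0c x2T (near_embed ne xy); by rewrite !inE ?x1C ?y1C ?nx1 ?ny1.
  by rewrite mem_imset //; apply: embed_inj.
pose eta w := if [pick b | embed l b == w] is Some b then eta0 b else eta0 w0.
have etaE b : eta (embed l b) = eta0 b.
  by rewrite /eta; case: pickP => [c /eqP/embed_inj->//|/(_ b)]; rewrite eqxx.
exists eta; split.
  move=> w w' wC w'C; have [[b eb] [b' eb']] := (CE w wC, CE w' w'C); subst w w'.
  by rewrite adjacent_embed !etaE; apply: eta_hom; rewrite inE.
move=> _ /amalgam_liftsP[l' [t [tL ->]]] v v'; rewrite !ffunE => vC v'C nvv.
rewrite !proj_embed => nG; have [[b eb] [b' eb']] := (CE _ vC, CE _ v'C).
have [el|nl] := eqVneq l' l; first by subst l'; rewrite etaE; apply: eta_lift nG; rewrite ?inE.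
case/negP: nG; apply: embed_distinct nl eb eb' _; apply: contraNneq nvv => e.
by apply/eqP; apply: (GG_inj (sound_proj sP tL)); rewrite !ffunE.
Qed.

Lemma sound_amalgam (l : embedding) : sound G F GG amalgam.
Proof.
split.
- by case: (sound_point sP) => w; split; exact: (embed l w).
- move=> _ /amalgam_liftsP[l' [t [tL ->]]].
  suff -> : [ffun v => @proj _ _ amalgam ([ffun v => embed l' (t v)] v)] =
    [ffun v => proj (t v)] :> {ffun V -> U} by apply: (sound_proj sP).
  by apply/ffunP => v; rewrite !ffunE [LHS]proj_embed.
- move=> _ /amalgam_liftsP[l' [t [tL ->]]] x y; rewrite !ffunE adjacent_embed.
  exact: (sound_induced sP tL).
- exact: clean_amalgam.
exact: folds_amalgam.
Qed.

Lemma trace_embed l A (b : {set point P}) :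
  trace A (embed l @: b : {set point amalgam}) = embed l @: trace A b.
Proof.
apply/setP => w; rewrite inE; apply/andP/imsetP => [[/imsetP[u ub ->]]|[u]].
  by rewrite proj_embed => uA; exists u; rewrite // inE ub.
by rewrite inE => /andP[ub uA] ->; rewrite imset_f // proj_embed.
Qed.

Lemma proj_imset_embed l (b : {set point P}) :
  @proj _ _ amalgam @: (embed l @: b) = @proj _ _ P @: b.
Proof. by rewrite -imset_comp; apply: eq_imset => w; apply: proj_embed. Qed.

Lemma section_over_embed l A (r : {set point P}) :
  section_over A (embed l @: r : {set point amalgam}) = section_over A r.
Proof. by rewrite /section_over proj_imset_embed (card_imset _ (@embed_inj l)). Qed.

Lemma edge_over_embed l e (b : {set point P}) :
  edge_over F e b -> edge_over F e (embed l @: b : {set point amalgam}).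
Proof.
move=> [w [w' [ww' -> <-]]]; exists (embed l w), (embed l w').
by rewrite adjacent_embed !proj_embed imsetU !imset_set1.
Qed.

(** * From colourings of the amalgam to colourings of one copy *)

Section Transfer.
Variable D : {set {set U}}.
Let e0 := [set i; j].
Hypotheses (DG : D \subset edges G) (ND : e0 \notin D).
Variables (phi : {set point amalgam} -> nat) (R : {set U} -> {set U}).
Variables (f : {set U} -> {set point amalgam} -> nat) (l : embedding) (R1 R2 : bool).
Hypothesis dec : decides F phi R f D.

Definition pair_ij (x y : option (point P)) : {set point amalgam} :=
  [set (inl (inl ((val l).1 x)) : point amalgam); inl (inr ((val l).2 y))].

Hypothesis tauE : forall x y x' y', edge_ij x y -> edge_ij x' y' -> {in D, forall e : {set U},
  R e \subset e0 -> (phi (pair_ij x y) == f e (trace (R e) (pair_ij x y))) =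
                    (phi (pair_ij x' y') == f e (trace (R e) (pair_ij x' y')))}.
Hypothesis phiE : forall x y x' y', edge_ij x y -> edge_ij x' y' ->
  (phi (pair_ij x y) == phi (pair_ij x' y')) = (R1 ==> (x == x')) && (R2 ==> (y == y')).

Let R' e := if e == e0 then [set k | (k == i) && R1 || (k == j) && R2] else R e.

(** Where [r] has no vertex over [k], the value [None] is the added vertex: it completes a section
    over a proper subset of [e0] to an edge, to which [tauE] and [phiE] apply. *)
Let over k (r : {set point P}) := [pick w in r | proj w == k].

Let f' e r := if e == e0 then phi (pair_ij (over i r) (over j r)) else f e (embed l @: r).

Lemma mem_trace_pair A x y w : (w \in trace A (pair_ij x y)) =
  (i \in A) && (w == inl (inl ((val l).1 x))) || (j \in A) && (w == inl (inr ((val l).2 y))).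
Proof.
rewrite !inE andb_orl [(i \in A) && _]andbC [(j \in A) && _]andbC.
by congr (_ || _); case: eqP => // ->.
Qed.

Lemma trace_pair_eq (A : {set U}) x y x' y' :
  (trace A (pair_ij x y) == trace A (pair_ij x' y')) =
  ((i \in A) ==> (x == x')) && ((j \in A) ==> (y == y')).
Proof.
have [i1 i2 _] := embP l; apply/eqP/andP => [/setP e|[/implyP ix /implyP jy]].
  split; apply/implyP => kA.
    have := e (inl (inl ((val l).1 x))); rewrite !mem_trace_pair kA eqxx /=.
    by case: eqP => [[/i1->]|_]; rewrite // andbF.
  have := e (inl (inr ((val l).2 y))); rewrite !mem_trace_pair kA eqxx /= !andbF /=.
  by case: eqP => [[/i2->]|].
apply/setP => w; rewrite !mem_trace_pair.
by case iA: (i \in A) ix => ix; case jA: (j \in A) jy => jy //=; rewrite ?(eqP (ix isT)) ?(eqP (jy isT)).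
Qed.

Lemma section_trace_pair (A : {set U}) x y : A \subset e0 -> section_over A (trace A (pair_ij x y)).
Proof.
move=> /subsetP sA; apply/andP; split.
  apply/eqP/setP => k; apply/imsetP/idP => [[w]|kA].
    by rewrite mem_trace_pair => /orP[]/andP[kA /eqP->] ->.
  have := sA k kA; rewrite !inE => /pred2P[] ek; subst k.
    by exists (inl (inl ((val l).1 x))); rewrite ?mem_trace_pair ?kA ?eqxx.
  by exists (inl (inr ((val l).2 y))); rewrite ?mem_trace_pair ?kA ?eqxx ?orbT.
apply/imset_injP => w w'; rewrite !mem_trace_pair.
by case/orP=> /andP[_ /eqP->]; case/orP=> /andP[_ /eqP->] //= e; case/eqP: neq_ij; rewrite e.
Qed.

Lemma over_section (A : {set U}) (r : {set point P}) : A \subset e0 -> section_over A r ->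
  embed l @: r = trace A (pair_ij (over i r) (over j r)).
Proof.
move=> /subsetP sA /andP[/eqP pr /imset_injP ri].
have overE w : w \in r -> over (proj w) r = Some w.
  move=> wr; rewrite /over; case: pickP => [w' /andP[w'r /eqP/ri->]//|/(_ w)].
  by rewrite wr eqxx.
apply/setP => w; rewrite mem_trace_pair; apply/imsetP/orP => [[u ur ->]|].
  have uA : proj u \in A by rewrite -pr imset_f.
  rewrite /embed; have := sA _ uA; rewrite !inE => /pred2P[]eu; rewrite eu.
    by left; rewrite eqxx -eu uA overE ?eqxx.
  by right; rewrite (eq_sym j) (negbTE neq_ij) eqxx -eu uA overE ?eqxx.
rewrite -pr; case=> /andP[/imsetP[u ur eu] /eqP->]; exists u => //; rewrite /embed -eu.
  by rewrite eqxx eu overE.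
by rewrite (eq_sym j) (negbTE neq_ij) eqxx eu overE.
Qed.

Lemma over_none k (A : {set U}) (r : {set point P}) : section_over A r -> k \notin A -> over k r = None.
Proof.
move=> /andP[/eqP <- _] /imsetP kN; rewrite /over; case: pickP => // w /andP[wr /eqP ek].
by case: kN; exists w.
Qed.

Lemma edge_over_ij (b : {set point P}) : edge_over F e0 b -> exists w w',
  [/\ edge_ij (Some w) (Some w'), proj w = i, proj w' = j, b = [set w; w'] &
      embed l @: b = pair_ij (Some w) (Some w')].
Proof.
have key w w' : adjacent F w w' -> proj w = i -> proj w' = j -> edge_ij (Some w) (Some w') /\
    embed l @: [set w; w'] = pair_ij (Some w) (Some w').
  move=> ww' pw pw'; split; first by rewrite /= pw pw' !eqxx.
  by rewrite imsetU !imset_set1 /embed pw pw' eqxx (eq_sym j) (negbTE neq_ij) eqxx.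
move=> [w [w' [ww' -> /set2_eq[] [pw pw']]]].
  by have [? ?] := key _ _ ww' pw pw'; exists w, w'.
rewrite adjacent_sym in ww'; have [? ?] := key _ _ ww' pw' pw.
by exists w', w; rewrite setUC.
Qed.

Let R'E : R' e0 = [set k | (k == i) && R1 || (k == j) && R2].
Proof. by rewrite /R' eqxx. Qed.

Let iR' : (i \in R' e0) = R1.
Proof. by rewrite R'E inE eqxx (negbTE neq_ij) /= orbF. Qed.

Let jR' : (j \in R' e0) = R2.
Proof. by rewrite R'E inE eqxx (eq_sym j) (negbTE neq_ij). Qed.

Let R'sub : R' e0 \subset e0.
Proof. by apply/subsetP => k; rewrite R'E !inE => /orP[]/andP[->]; rewrite ?orbT. Qed.

Let R'full : R1 -> R2 -> R' e0 = e0.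
Proof. by move=> r1 r2; apply/setP => k; rewrite R'E !inE r1 r2 !andbT. Qed.

Let over_edge r : R' e0 != e0 -> section_over (R' e0) r -> edge_ij (over i r) (over j r).
Proof.
move=> nf sr; have [iA|iA] := boolP (i \in R' e0); last by rewrite (over_none sr iA).
have [jA|jA] := boolP (j \in R' e0); last by rewrite (over_none sr jA); case: (over i r).
by case/eqP: nf; apply: R'full; rewrite -?iR' -?jR'.
Qed.

Let inD e : e \in D -> [/\ e == e0 = false, R' e = R e & forall r, f' e r = f e (embed l @: r)].
Proof.
move=> eD; have ne : e == e0 = false by apply: contraNF ND => /eqP <-.
by rewrite /R' /f' ne.
Qed.

(** By [tauE] the colour that [e] predicts is right for all edges over [e0] or for none. If for all,
    both roots describe the same partition of these edges and therefore coincide. *)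
Lemma compatible_new e : e \in D ->
  compatible F (fun b : {set point P} => phi (embed l @: b)) R' f' e e0.
Proof.
move=> eD; have [ne Re fe] := inD eD; rewrite /compatible Re.
have [sub|nsub] := boolP (R e \subset e0); last by constructor 1.
have ce : #|e| = 2.
  have /edgesP[x [y [Gxy ->]]] := subsetP DG e eD.
  by rewrite cards2 (contraTneq _ Gxy) // => ->; rewrite adj_irr.
have ce0 : #|e0| = 2 by rewrite cards2 neq_ij.
(* [R e] lies in two different pairs, hence properly in each, so the injectivity on sections is
   available. *)
have nfull : R e != e.
  by apply: contraFN ne => /eqP eR; rewrite eR in sub; rewrite eqEcard sub ce ce0.
have nfull0 : R e != e0.
  apply: contraFN ne => /eqP eR; have := root_sub dec eD; rewrite eR => sub'.
  by rewrite eq_sym eqEcard sub' ce ce0.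
have NN : edge_ij None None by [].
have [allt|allf] := boolP (phi (pair_ij None None) == f e (trace (R e) (pair_ij None None))).
  have H x y : edge_ij x y -> phi (pair_ij x y) = f e (trace (R e) (pair_ij x y)).
    by move=> Exy; apply/eqP; rewrite (tauE Exy NN eD sub).
  have trE x y x' y' : edge_ij x y -> edge_ij x' y' ->
      (R1 ==> (x == x')) && (R2 ==> (y == y')) =
      ((i \in R e) ==> (x == x')) && ((j \in R e) ==> (y == y')).
    move=> Exy Exy'; rewrite -phiE // !H // -trace_pair_eq; apply/eqP/eqP => [|->//].
    by apply: (root_inj_section dec eD nfull); apply: section_trace_pair.
  (* [Some w0] and [None] are both joined to [None]; two edges that differ on one side only reveal
     whether that side belongs to the root. *)
  have [w0] := sound_point sP.
  have r1 : R1 = (i \in R e).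
    by have := trE (Some w0) None None None isT isT; rewrite /= !implybT !andbT;
      case: R1; case: (i \in R e).
  have r2 : R2 = (j \in R e).
    by have := trE None (Some w0) None None isT isT; rewrite /= !implybT /=;
      case: R2; case: (j \in R e).
  have eR : R' e0 = R e.
    apply/setP => k; rewrite R'E inE r1 r2; apply/orP/idP => [[]/andP[/eqP->]//|kR].
    by have := subsetP sub k kR; rewrite !inE => /orP[]/eqP ek; subst k; rewrite eqxx kR; [left|right].
  constructor 2; split=> // r sr; rewrite fe /f' eqxx (over_section sub sr) -H //.
  by apply: over_edge; rewrite eR.
have H x y : edge_ij x y -> phi (pair_ij x y) <> f e (trace (R e) (pair_ij x y)).
  by move=> Exy; apply/eqP; rewrite (tauE Exy NN eD sub).
constructor 3; split=> // [b /edge_over_ij[w [w' [Eww' _ _ _ eb]]]|eR r sr].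
  by rewrite fe -trace_embed eb; apply: H.
rewrite fe (over_section sub sr) /f' eqxx => /esym; apply: H.
by apply: over_edge; rewrite -eR.
Qed.

Lemma compatible_embed e e' : e \in D -> e' \in D -> compatible F phi R f e e' ->
  compatible F (fun b : {set point P} => phi (embed l @: b)) R' f' e e'.
Proof.
move=> eD e'D; have [_ Re fe] := inD eD; have [_ Re' fe'] := inD e'D.
rewrite /compatible Re Re'; case=> [nsub|[eR ef]|[sub nphi nf]]; first by constructor 1.
  by constructor 2; split=> // r sr; rewrite fe fe' ef // section_over_embed.
constructor 3; split=> // [b be|eR r sr].
  by rewrite fe -trace_embed; apply/nphi/edge_over_embed.
by rewrite fe fe'; apply: nf; rewrite // section_over_embed.
Qed.

Lemma decides_extend : decides F (fun b : {set point P} => phi (embed l @: b)) R' f' (e0 |: D).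
Proof.
have imi := imset_inj (@embed_inj l).
split.
- move=> e /setU1P[->//|eD]; have [_ -> _] := inD eD; apply: (root_sub dec eD).
- move=> e /setU1P[->|eD] b be; last first.
    have [_ -> ->] := inD eD; rewrite -trace_embed; apply: (root_colour dec eD).
    exact: edge_over_embed.
  have [w [w' [Eww' pw pw' eb eq]]] := edge_over_ij be.
  rewrite eq /f' eqxx; set tr := trace _ b; apply/eqP.
  have str : section_over (R' e0) tr.
    by rewrite -(section_over_embed l) -trace_embed eq section_trace_pair.
  have /eqP := over_section R'sub str; rewrite -trace_embed eq trace_pair_eq iR' jR' => ov.
  rewrite phiE //; move: ov; case r1: R1; last by rewrite (over_none str) ?iR' ?r1.
  by case r2: R2; [move=> /andP[/eqP <- /eqP <-]|rewrite (over_none (k := j) str) ?jR' ?r2; case: over].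
- move=> e /setU1P[->|eD] b b' be be' ephi; apply: imi; rewrite -!trace_embed; last first.
    have [_ -> _] := inD eD.
    by apply: (root_inj dec eD) ephi; apply: edge_over_embed.
  have [w1 [w1' [E1 _ _ _ eq1]]] := edge_over_ij be.
  have [w2 [w2' [E2 _ _ _ eq2]]] := edge_over_ij be'.
  apply/eqP; rewrite eq1 eq2 trace_pair_eq iR' jR' -phiE // -eq1 -eq2; exact/eqP.
- move=> e /setU1P[->|eD] r r' nf sr sr' ef; apply: imi; last first.
    have [_ eR fe] := inD eD; rewrite eR in nf sr sr'.
    by apply: (root_inj_section dec eD nf); rewrite ?section_over_embed // -!fe.
  rewrite (over_section R'sub sr) (over_section R'sub sr'); apply/eqP.
  rewrite trace_pair_eq iR' jR' -phiE ?over_edge //; apply/eqP.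
  by move: ef; rewrite /f' eqxx.
move=> e e' /setU1P[->|eD] /setU1P[->|e'D]; rewrite ?eqxx // => ne.
- by right; apply: compatible_new.
- by left; apply: compatible_new.
by case: (root_compatible dec eD e'D ne) => c; [left|right]; apply: compatible_embed.
Qed.
End Transfer.

(** The auxiliary colour of a pair is the set of all decided [e] that predict its colour correctly,
    so one use of the partite lemma settles all comparisons with [D]. *)
Lemma transfers_amalgam (D : {set {set U}}) :
  D \subset edges G -> [set i; j] \notin D ->
  (forall (phi : X' -> Y' -> nat) (tau : X' -> Y' -> {set {set U}}),
    exists (a : option (point P) -> X') (b : option (point P) -> Y') (R1 R2 : bool),
    [/\ injective a, injective b, forall x y, E' (a x) (b y) = edge_ij x y,
      forall x y x' y', edge_ij x y -> edge_ij x' y' -> tau (a x) (b y) = tau (a x') (b y') &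
      forall x y x' y', edge_ij x y -> edge_ij x' y' ->
        (phi (a x) (b y) == phi (a x') (b y')) = (R1 ==> (x == x')) && (R2 ==> (y == y'))]) ->
  (forall (phi : {set point P} -> nat) R f, decides F phi R f ([set i; j] |: D) ->
    transfers F GG phi) ->
  forall (phi : {set point amalgam} -> nat) R f, decides F phi R f D -> transfers F GG phi.
Proof.
move=> DG ND part tP phi R f dec.
pose q x' y' : {set point amalgam} := [set (inl (inl x') : point amalgam); inl (inr y')].
have [a [b [R1 [R2 [ai bi El tauE phiE]]]]] := part (fun x' y' => phi (q x' y')) (fun x' y' =>
  [set e in D | (R e \subset [set i; j]) && (phi (q x' y') == f e (trace (R e) (q x' y')))]).
have l_emb : is_emb ([ffun x => a x], [ffun y => b y]).
  apply/and3P; split; [| |by apply/forallP => x; apply/forallP => y; rewrite !ffunE El].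
  - by apply/injectiveP => x y; rewrite !ffunE => /ai.
  - by apply/injectiveP => x y; rewrite !ffunE => /bi.
pose l : embedding := Sub _ l_emb.
have qE x y : pair_ij l x y = q (a x) (b y) by rewrite /pair_ij /q /= !ffunE.
have dec' := @decides_extend D DG ND phi R f l R1 R2 dec _ _.
have {tP dec'} [||psi psiP] := tP _ _ _ (dec' _ _).
- move=> x y x' y' Exy Exy' e eD sub; have /setP/(_ e) := tauE _ _ _ _ Exy Exy'.
  by rewrite !inE eD sub !qE.
- by move=> x y x' y' Exy Exy'; rewrite !qE phiE.
exists psi => g gG; have [s sL [sg sphi]] := psiP g gG.
exists [ffun v => embed l (s v)]; first exact: lift_embed.
split=> [v|e e' eF e'F]; first by rewrite ffunE proj_embed.
have im (A : {set V}) : [ffun v => embed l (s v)] @: A = embed l @: (s @: A).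
  by rewrite -imset_comp; apply: eq_imset => v; rewrite ffunE.
by rewrite !im sphi.
Qed.
End Amalgamation.

(** * Iteration *)

Section Construction.
Variables (U V : finType) (G : graph U) (F : graph V) (GG : {set {ffun V -> U}}).
Hypothesis GG_inj : {in GG, forall g : {ffun V -> U}, injective g}.
Hypothesis GG_hom : {in GG, forall (g : {ffun V -> U}) x y, F x y -> G (g x) (g y)}.

(** Being decided on all of [edges G] suffices for the initial picture; being decided on nothing is
    no condition. The picture for [D] is an amalgam of the one for [e |: D], so edges amalgamated
    later are decided earlier. *)
Lemma transferring_picture g (v : V) : g \in GG -> exists P : picture U V,
  sound G F GG P /\ forall phi : {set point P} -> nat, transfers F GG phi.
Proof.
move=> gG.
suff /(_ set0 (sub0set _)) [P [sP tP]] : forall D : {set {set U}}, D \subset edges G ->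
    exists P : picture U V, sound G F GG P /\
      forall (phi : {set point P} -> nat) R f, decides F phi R f D -> transfers F GG phi.
  exists P; split=> // phi; apply: (tP phi (fun _ => set0) (fun _ _ => 0)).
  by split=> [e|e|e|e|e e']; rewrite inE.
move=> D; have [n] := ubnP #|edges G :\: D|.
elim: n D => // n IHn D; rewrite ltnS => leDn DG.
have [e0|/set0Pn[e]] := eqVneq (edges G :\: D) set0.
  have -> : D = edges G by apply/eqP; rewrite eqEsubset DG -setD_eq0 e0 eqxx.
  exists (picture0 F GG #|{: {set V} * {set V}}|); split; first exact: sound0 v gG.
  by move=> phi R f dec; apply: transfers0 dec _ => //.
rewrite inE => /andP[eD eG]; have /edgesP[i [j [Gij ee]]] := eG.
have [||P [sP tP]] := IHn (e |: D).
- rewrite (leq_trans _ leDn) // [in X in _ < X](cardsD1 e) inE eD eG ltnS.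
  by apply/subset_leq_card/subsetP => x; rewrite !inE negb_or -andbA.
- by rewrite subUset sub1set eG.
have [X' [Y' [E' part]]] := canonical_partite {set {set U}} (@edge_ij _ _ F P i j).
exists (@amalgam _ _ F P i j X' Y' E'); split.
  (* An arbitrary colouring: only the existence of an embedding is wanted. *)
  have [a [b [_ [_ [ai bi El _ _]]]]] := part (fun _ _ => 0) (fun _ _ => set0).
  have l_emb : is_emb F i j E' ([ffun x => a x], [ffun y => b y]).
    apply/and3P; split; [| |by apply/forallP => x; apply/forallP => y; rewrite !ffunE El].
    - by apply/injectiveP => x y; rewrite !ffunE => /ai.
    - by apply/injectiveP => x y; rewrite !ffunE => /bi.
  by apply: sound_amalgam => //; exact: (Sub _ l_emb).
subst e => phi R f; exact: (transfers_amalgam GG_hom sP Gij DG eD part tP).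
Qed.
End Construction.

(** * Shortest walks and shortest odd closed walks have no chords *)

Section Walks.
Variables (T : eqType) (e : rel T).

Lemma spread (A : pred T) s : symmetric e -> sorted e s ->
  {in s &, forall x y, A x -> e x y -> A y} -> {in s &, forall x y, A x -> A y}.
Proof.
move=> e_sym; case: s => // x s /= es clo.
suff H : {in s, forall y, A y = A x}.
  by move=> y z; rewrite !inE => /predU1P[->|/H->] /predU1P[->|/H->].
elim: s x es clo => // z s IHs x /= /andP[exz es] clo.
have Azx : A z = A x.
  by apply/idP/idP => Aw; apply: (clo _ _ _ _ Aw);
    rewrite ?inE ?eqxx ?orbT // e_sym.
move=> y; rewrite inE => /predU1P[->//|ys]; rewrite -Azx; apply: IHs ys => // a b aI bI.
by apply: clo; rewrite inE ?aI ?bI orbT.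
Qed.

Lemma not_uniq_split (s : seq T) : ~~ uniq s ->
  exists s1 x s2 s3, s = s1 ++ x :: s2 ++ x :: s3.
Proof.
elim: s => //= x s IHs; rewrite negb_and negbK => /orP[/splitPr[s2 s3]|/IHs[s1 [y [s2 [s3 ->]]]]].
  by exists [::], x, s2, s3.
by exists (x :: s1), y, s2, s3.
Qed.

Lemma geodesic x p : path e x p ->
  (forall q, path e x q -> last x q = last x p -> size p <= size q) ->
  uniq (x :: p) /\ forall s1 u s2 v s3, x :: p = s1 ++ u :: s2 ++ v :: s3 -> e u v -> s2 = [::].
Proof.
move=> exp short; split.
  have [q [eq lq uq sub]] : exists q, [/\ path e x q, last x q = last x p, uniq (x :: q)
      & {subset q <= p}] by case: (shortenP exp) => q *; exists q.
  apply: (leq_size_uniq uq); last by rewrite ltnS short.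
  by move=> y; rewrite !inE => /orP[->//|/sub->]; rewrite orbT.
move=> [|y s1] u s2 v s3 /= [exy ep] euv; subst.
  move: exp; rewrite cat_path /= => /and3P[_ _ vs3].
  have := short (v :: s3); rewrite last_cat /= euv vs3 => /(_ isT erefl).
  by rewrite size_cat /=; case: s2 {short} => //= ? ?; lia.
move: exp; rewrite cat_path /= cat_path /= => /and3P[p1 l1 /and3P[_ _ p3]].
have := short (s1 ++ u :: v :: s3); rewrite cat_path /= p1 l1 euv p3 !last_cat /= last_cat /=.
move=> /(_ isT erefl); rewrite !size_cat /= size_cat /=.
by case: s2 {short} => //= ? ?; lia.
Qed.

Lemma cycle_cat2 x p1 y p2 : cycle e (x :: p1 ++ y :: p2) =
  [&& path e x p1, e (last x p1) y, path e y p2 & e (last y p2) x].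
Proof. by rewrite /= rcons_cat cat_path /= rcons_path. Qed.

Hypothesis e_sym : symmetric e.
Variable c : seq T.
Hypotheses (ec : cycle e c) (oc : odd (size c)).
Hypothesis short : forall c', cycle e c' -> odd (size c') -> size c <= size c'.

(** A repeated vertex cuts [c] into two closed walks, one of them odd and shorter. *)
Lemma odd_cycle_uniq : uniq c.
Proof.
apply: contraT => /not_uniq_split[s1 [x [s2 [s3 es]]]].
have := ec; rewrite -(rot_cycle (size s1)) es rot_size_cat cat_cons -catA cat_cons.
rewrite cycle_cat2 => /and4P[p2 l2 p3 l3].
have szc : size c = (size (x :: s2) + size (x :: s3 ++ s1)).
  by rewrite es !(size_cat, size_cat) /= !(size_cat) /=; lia.
have := oc; rewrite szc oddD.
case o2: (odd (size (x :: s2))) => [|]; rewrite ?addFb => o3.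
  by have := @short (x :: s2); rewrite o2 /= rcons_path p2 l2 szc /=; lia.
have := @short (x :: s3 ++ s1); rewrite o3 /= rcons_path p3 l3 szc /=; lia.
Qed.

(** A chord cuts [c] into two closed walks of total length [size c + 2]. The odd one is shorter than
    [c] unless the other has length 2. *)
Lemma odd_cycle_chord k u p1 v p2 : rot k c = u :: p1 ++ v :: p2 -> e u v ->
  p1 = [::] \/ p2 = [::].
Proof.
move=> erot euv; have := ec; rewrite -(rot_cycle k) erot cycle_cat2.
case/and4P=> q1 l1 q2 l2.
have szc : (size c).+2 = (size (u :: rcons p1 v) + size (v :: rcons p2 u)).
  by rewrite -(size_rot k) erot /= !(size_cat, size_rcons) /=; lia.
have : odd (size c).+2 by rewrite /= negbK.
rewrite szc oddD; case: p1 p2 {erot} q1 l1 q2 l2 szc => [|a p1] [|b p2] q1 l1 q2 l2 szc;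
  try by [left|right].
case o2: (odd (size (u :: rcons (a :: p1) v))) => [|]; rewrite ?addFb => o3.
  have := @short (u :: rcons (a :: p1) v).
  rewrite o2 /cycle !rcons_path last_rcons q1 l1 e_sym euv => /(_ isT isT).
  by move: szc; rewrite /= !size_rcons /=; lia.
have := @short (v :: rcons (b :: p2) u).
rewrite o3 /cycle !rcons_path last_rcons q2 l2 euv => /(_ isT isT).
by move: szc; rewrite /= !size_rcons /=; lia.
Qed.
End Walks.

Lemma uniq_map_inj (T T' : eqType) (f : T -> T') s : uniq (map f s) -> {in s &, injective f}.
Proof.
move=> uf x y xs ys exy; rewrite -(nth_index x xs) -(nth_index x ys); congr nth.
apply/eqP; rewrite -(nth_uniq (f x) _ _ uf) ?size_map ?index_mem //.
by rewrite !(nth_map x) ?index_mem // !nth_index // exy.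
Qed.

Lemma cycle_cat_sorted (T : eqType) (e : rel T) s1 s2 : cycle e (s1 ++ s2) -> sorted e s2.
Proof.
rewrite -(rot_cycle (size s1)) rot_size_cat; case: s2 => //= y s2.
by rewrite rcons_cat cat_path => /andP[].
Qed.

Section Robust.
Variables (U V : finType) (G : graph U) (F : graph V) (P : picture U V).

(** Vertices with adjacent images are consecutive on some such cycle, so what is removed is an
    interval and a walk remains. Using [near] admits paths that are closed up inside a lift. *)
Lemma robust_cycle (c : seq (point P)) : cycle (near G F (P := P)) c ->
  uniq (map (@proj _ _ P) c) ->
  {in c &, forall u v, G (proj u) (proj v) -> exists a b p,
    [/\ a = u /\ b = v \/ a = v /\ b = u, cycle (near G F (P := P)) (a :: b :: p),
        uniq (a :: b :: p) & a :: b :: p =i c]} ->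
  robust G F [set w in c].
Proof.
move=> nc up chord i0 j0 ij T; set S := [set w in _ | _] => Tc a b aS bS aT.
have ci := uniq_map_inj up; have uc := map_uniq up.
pose out (w : point P) := (proj w != i0) && (proj w != j0).
have [pre [rest [cpr epr /allP ppre /allP prest]]] : exists pre rest,
    [/\ cycle (near G F (P := P)) (pre ++ rest), pre ++ rest =i c,
        all (predC out) pre & all out rest].
  have one u : u \in c -> ~~ out u -> {in c, forall v, v != u -> out v} -> exists pre rest,
      [/\ cycle (near G F (P := P)) (pre ++ rest), pre ++ rest =i c,
          all (predC out) pre & all out rest].
    move=> /rot_to[k s es] uo H; exists [:: u], s; rewrite cat1s -es rot_cycle.
    split=> //; [exact: mem_rot|by rewrite /= uo|].
    apply/allP => v vs; apply: H; first by rewrite -(mem_rot k) es inE vs orbT.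
    by apply: contraTneq vs => ->; move: uc; rewrite -(rot_uniq k) es => /andP[].
  have [/hasP[u uc' uo]|/hasPn no] := boolP (has (predC out) c); last first.
    by exists [::], c; split=> //; apply/allP => w /no; rewrite negbK.
  have [/hasP[v vc /andP[vo nvu]]|/hasPn no] := boolP (has (fun v => ~~ out v && (v != u)) c);
    last by apply: (one u) => // v /no; rewrite negb_and negbK => /orP[->//|/negP H /H].
  rewrite /= in uo.
  have npuv : proj u != proj v by apply: contra nvu => /eqP/ci->.
  have Guv : G (proj u) (proj v).
    move: uo vo npuv; rewrite /out /= !negb_and !negbK.
    case/orP: ij => [/eqP->|G0]; first by rewrite !orbb => /eqP-> /eqP->; rewrite eqxx.
    by case/pred2P=> -> /pred2P[]->; rewrite ?eqxx // adj_sym.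
  have [a1 [b1 [p [eab cab uab mab]]]] := chord u v uc' vc Guv.
  exists [:: a1; b1], p; split=> //=.
    by case: eab => -[-> ->]; rewrite /= uo vo.
  apply/allP => w wp; have wc : w \in c by rewrite -mab !inE wp !orbT.
  have [nwa nwb] : w != a1 /\ w != b1.
    by move: uab => /= /and3P[]; rewrite inE => /norP[_ na] nb _;
      split; apply: contraTneq wp => ->.
  have nw : w != u /\ w != v by case: eab => -[<- <-].
  have {nw} [npu npv] : proj w != proj u /\ proj w != proj v.
    by case: nw => nu nv; split; [apply: contra nu|apply: contra nv] => /eqP/ci->.
  move: uo vo npuv npu npv; rewrite /out /= !negb_and !negbK.
  by case/pred2P=> -> /pred2P[]->; rewrite ?eqxx // => _ -> ->.
have memS w : w \in S -> w \in rest.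
  rewrite !inE => /andP[wc wo]; move: wc; rewrite -epr mem_cat => /orP[/ppre|//].
  by rewrite /= /out wo.
apply: (spread (A := mem T) (@near_sym _ _ G F P) (cycle_cat_sorted cpr) _ (memS a aS) (memS b bS)) => //.
move=> x y xr yr xT; apply: Tc => //; rewrite !inE.
  by rewrite -epr mem_cat xr orbT; apply: prest.
by rewrite -epr mem_cat yr orbT; apply: prest.
Qed.
End Robust.

(** * Levels of control and the passage to the next level *)

Section Systems.
Variables (d : Order.disp_t) (V : finOrderType d) (F : graph V).

Lemma canonical_ker (phi psi : {set V} -> nat) :
  {in edges F &, forall e e' : {set V}, (phi e == phi e') = (psi e == psi e')} ->
  canonical F psi -> canonical F phi.
Proof.
move=> ker; have kP e e' : e \in edges F -> e' \in edges F -> phi e = phi e' <-> psi e = psi e'.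
  by move=> eF e'F; split=> /eqP; [rewrite ker // => /eqP|rewrite -ker // => /eqP].
case=> H; [constructor 1|constructor 2|constructor 3|constructor 4] => e e' eF e'F.
- by apply/kP => //; apply: H.
- by rewrite kP //; apply: H.
- by rewrite kP //; apply: H.
by move/kP => ephi; apply: H => //; apply: ephi.
Qed.

(* The level t says how far odd cycles and distances are controlled. At level 0 the
   copies of F need not even be induced. The map rho orders the vertices. *)
Record system (U : finType) (G : graph U) (GG : {set {ffun V -> U}}) (rho : U -> nat) (t : nat) :
    Prop := System {
  sys_mono : {in GG, forall (g : {ffun V -> U}) x y, (x < y)%O -> rho (g x) < rho (g y)};
  sys_hom : {in GG, forall (g : {ffun V -> U}) x y, F x y -> G (g x) (g y)};
  sys_canonical : forall phi : {set U} -> nat,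
    exists2 g : {ffun V -> U}, g \in GG & canonical F (fun e => phi (g @: e));
  sys_induced : 0 < t -> {in GG, forall (g : {ffun V -> U}) x y, G (g x) (g y) -> F x y};
  sys_clique : 0 < t -> forall K, clique G K -> 2 < #|K| ->
    exists eta : U -> V, {in K &, forall x y, G x y -> F (eta x) (eta y)};
  sys_odd : forall c, cycle G c -> odd (size c) -> size c <= t ->
    exists c', [/\ cycle F c', odd (size c') & size c' <= size c];
  sys_dist : {in GG, forall (g : {ffun V -> U}) x y p, path G (g x) p -> last (g x) p = g y ->
    size p < t -> exists q, [/\ path F x q, last x q = y & size q <= size p]}
}.

Lemma sys_inj U (G : graph U) GG rho t : system G GG rho t ->
  {in GG, forall g : {ffun V -> U}, injective g}.
Proof.
move=> sys g gG x y e; apply/eqP; apply: contraT; rewrite neq_lt => /orP[] /(sys_mono sys gG);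
  by rewrite e ltnn.
Qed.

Section Step.
Variables (U : finType) (G : graph U) (GG : {set {ffun V -> U}}) (rho : U -> nat) (t : nat).
Hypothesis sys : system G GG rho t.
Variable P : picture U V.
Hypotheses (sP : sound G F GG P) (tP : forall phi : {set point P} -> nat, transfers F GG phi).

Let GG_inj := sys_inj sys.
Let GG_hom := sys_hom sys.

Lemma adjacent_irr : irreflexive (adjacent F (P := P)).
Proof. by move=> w; apply/negbTE/negP => aw; have := adjacent_proj GG_hom sP aw; rewrite adj_irr. Qed.

Definition picture_graph : graph (point P) := Graph (@adjacent_sym _ _ F P) adjacent_irr.

(** Every part of a clique is connected, so cliques are robust and fold. *)
Lemma next_clique K : clique picture_graph K -> 2 < #|K| ->
  exists eta : point P -> V, {in K &, forall x y, picture_graph x y -> F (eta x) (eta y)}.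
Proof.
move=> cK K3.
have adjK : {in K &, forall x y, x != y -> adjacent F x y}.
  move=> x y xK yK; move/forall_inP: cK => /(_ x xK)/forall_inP/(_ y yK)/implyP; exact.
have [||eta [eta_hom _]] := sound_folds sP (C := K) K3.
- move=> x y xK yK e; apply/eqP; apply: contraT => nxy; have := adjacent_proj GG_hom sP (adjK _ _ xK yK nxy).
  by rewrite e adj_irr.
- move=> i j ij T Tc a b aS bS aT; have [<-//|nab] := eqVneq a b.
  have [/setIdP[aK _] /setIdP[bK _]] := (aS, bS).
  by apply: Tc aS bS aT _; rewrite /near adjK.
by exists eta.
Qed.

(** If [G] has a shorter odd closed walk, level [t] applies to it. Otherwise [c] projects to a
    shortest one, hence to an induced cycle, and folds. *)
Lemma next_odd c : cycle picture_graph c -> odd (size c) -> size c <= t.+1 ->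
  exists c', [/\ cycle F c', odd (size c') & size c' <= size c].
Proof.
move=> cc oc sc.
have cG : cycle G (map (@proj _ _ P) c).
  rewrite cycle_map; apply: sub_cycle cc => x y axy; exact: (adjacent_proj GG_hom sP axy).
have [/existsP[n /existsP[c' /andP[cc' oc']]]|noc] := boolP
    [exists n : 'I_(size c), exists c' : n.-tuple U, cycle G c' && odd (size c')].
  have szc' : size c' <= size c by rewrite size_tuple ltnW.
  have [|c2 [? ? sc2]] := sys_odd sys cc' oc'.
    by rewrite size_tuple -ltnS (leq_trans (ltn_ord n)).
  by exists c2; split=> //; apply: leq_trans szc'.
have short c' : cycle G c' -> odd (size c') -> size (map (@proj _ _ P) c) <= size c'.
  move=> cc' oc'; rewrite size_map leqNgt; apply: contra noc => lt_c'.
  by apply/existsP; exists (Ordinal lt_c'); apply/existsP; exists (in_tuple c'); rewrite /= cc'.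
have oG : odd (size (map (@proj _ _ P) c)) by rewrite size_map.
have uG := odd_cycle_uniq cG oG short.
have c3 : 2 < #|[set w in c]|.
  rewrite cardsE (card_uniqP (map_uniq uG)); move: cc oc.
  case: (c) => [|x [|y [|? ?]]] //=; by rewrite adjacent_irr.
have pi : {in [set w in c] &, injective (@proj _ _ P)}.
  by move=> x y; rewrite !inE; apply: uniq_map_inj.
have nc : cycle (near G F (P := P)) c.
  by apply: sub_cycle cc => x y; rewrite /near /= => ->.
have [|eta [eta_hom _]] := sound_folds sP c3 pi.
  apply: (robust_cycle nc uG) => u v uc vc Guv.
  have nuv : u != v by apply: contraTneq Guv => ->; rewrite adj_irr.
  case/rot_to: (uc) => k s es.
  have vs : v \in s by move: vc; rewrite -(mem_rot k) es inE eq_sym (negbTE nuv).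
  case/splitPr: vs es => p1 p2 es.
  have uc' : uniq (u :: p1 ++ v :: p2) by rewrite -es rot_uniq (map_uniq uG).
  have cc' : cycle (near G F (P := P)) (u :: p1 ++ v :: p2) by rewrite -es rot_cycle.
  have mc' : u :: p1 ++ v :: p2 =i c by move=> w; rewrite -es mem_rot.
  have := @odd_cycle_chord _ _ (adj_sym G) _ cG oG short k (proj u) (map (@proj _ _ P) p1) (proj v)
    (map (@proj _ _ P) p2).
  rewrite -map_rot es /= map_cat /= => /(_ erefl Guv) [] /(congr1 size); rewrite size_map /=.
    case: p1 {es} uc' cc' mc' => //= uc' cc' mc' _.
    by exists u, v, p2; split=> //; left.
  case: p2 {es} uc' cc' mc' => // uc' cc' mc' _; exists v, u, p1.
  have er : rotr 1 (u :: p1 ++ [:: v]) = v :: u :: p1 by rewrite -cat_cons cats1 rotr1_rcons.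
  have cr : cycle (near G F (P := P)) (v :: u :: p1) by rewrite -er /rotr rot_cycle.
  have ur : uniq (v :: u :: p1) by rewrite -er rotr_uniq.
  by split=> //; [right|rewrite -er => w; rewrite mem_rotr mc'].
exists (map eta c); rewrite size_map; split=> //.
by apply: (homo_cycle_in (P := mem c)) cc; [move=> x y xc yc; apply: eta_hom; rewrite inE|apply/allP].
Qed.

(** Either level [t] applies to a shorter walk in [G], or [p] projects to a geodesic. Ends that are
    not adjacent in [F] are not adjacent in [G], by inducedness, so [near] closes [p] to a cycle,
    and folding returns both ends to their labels. *)
Lemma next_dist : 0 < t -> {in lifts P, forall (s : {ffun V -> point P}) x y p,
  path picture_graph (s x) p -> last (s x) p = s y -> size p < t.+1 ->
  exists q, [/\ path F x q, last x q = y & size q <= size p]}.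
Proof.
move=> t0 s sL x y p ep lp sp.
have [g gG sg] : exists2 g, g \in GG & forall v, proj (s v) = g v.
  by exists [ffun v => proj (s v)]; [apply: (sound_proj sP)|move=> v; rewrite ffunE].
have pG : path G (g x) (map (@proj _ _ P) p).
  rewrite -sg path_map; apply: sub_path ep => u v auv; exact: (adjacent_proj GG_hom sP auv).
have lG : last (g x) (map (@proj _ _ P) p) = g y by rewrite -sg last_map lp sg.
have [/existsP[n /existsP[q /andP[eq /eqP lq]]]|noq] := boolP
    [exists n : 'I_(size p), exists q : n.-tuple U, path G (g x) q && (last (g x) q == g y)].
  have szq : size q <= size p by rewrite size_tuple ltnW.
  have [|q2 [? ? sq2]] := sys_dist sys gG eq lq.
    by rewrite size_tuple (leq_trans (ltn_ord n)).
  by exists q2; split=> //; apply: leq_trans szq.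
have short q : path G (g x) q -> last (g x) q = last (g x) (map (@proj _ _ P) p) ->
    size (map (@proj _ _ P) p) <= size q.
  rewrite lG size_map leqNgt => eq lq; apply: contra noq => lt_q.
  by apply/existsP; exists (Ordinal lt_q); apply/existsP; exists (in_tuple q); rewrite /= eq lq /=.
have [uG chord] := geodesic pG short.
have [exy|nxy] := eqVneq x y; first by exists [::].
have [Fxy|nFxy] := boolP (F x y).
  exists [:: y]; rewrite /= Fxy; split=> //.
  case: p lp {ep sp pG lG noq short uG chord} => // sxy; case/eqP: nxy.
  by apply: (sys_inj sys gG); rewrite -!sg -sxy.
have nG : ~~ G (proj (s x)) (proj (s y)).
  by apply: contra nFxy; rewrite !sg; apply: (sys_induced sys).
pose c := s x :: p.
have sxc : s x \in c by rewrite mem_head.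
have syc : s y \in c by rewrite -lp mem_last.
have uc : uniq (map (@proj _ _ P) c) by rewrite /= sg.
have c3 : 2 < #|[set w in c]|.
  rewrite cardsE (card_uniqP (map_uniq uc)) /= ltnS.
  case: p lp ep {sp pG lG noq short uG chord c sxc syc uc} => [|w [|? ?]] //=.
    by move=> e; case/eqP: nxy; apply: (sys_inj sys gG); rewrite -!sg -e.
  by move=> -> /andP[/(adjacent_proj GG_hom sP)]; rewrite (negbTE nG).
have pi : {in [set w in c] &, injective (@proj _ _ P)}.
  by move=> u v; rewrite inE => uc'; rewrite inE => vc; apply: (uniq_map_inj uc uc' vc).
have nc : cycle (near G F (P := P)) c.
  rewrite /= rcons_path; apply/andP; split.
    by apply: sub_path ep => u v; rewrite /near /= => ->.
  rewrite lp /near adj_sym nG orbC; apply/orP; left.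
  by apply/exists_inP; exists s; rewrite ?codom_f.
have [|eta [eta_hom eta_lift]] := sound_folds sP c3 pi.
  apply: (robust_cycle nc uc) => u v uc' vc Guv.
  have nuv : u != v by apply: contraTneq Guv => ->; rewrite adj_irr.
  have adj u' v' c1 c2 c3' : c = c1 ++ u' :: c2 ++ v' :: c3' -> G (proj u') (proj v') ->
      [/\ cycle (near G F (P := P)) (u' :: v' :: c3' ++ c1), uniq (u' :: v' :: c3' ++ c1) &
          u' :: v' :: c3' ++ c1 =i c].
    move=> ec Guv'.
    have := chord (map (@proj _ _ P) c1) (proj u') (map (@proj _ _ P) c2) (proj v')
      (map (@proj _ _ P) c3').
    rewrite -sg -map_cons -/c {1}ec !map_cat /= map_cat /= => /(_ erefl Guv').
    move/(congr1 size); rewrite size_map; case: c2 ec => // ec _.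
    have er : rot (size c1) c = u' :: v' :: c3' ++ c1 by rewrite ec rot_size_cat.
    split; last by move=> w; have := mem_rot (size c1) c w; rewrite er.
      by have := rot_cycle (size c1) (near G F (P := P)) c; rewrite er nc.
    by have := rot_uniq (size c1) c; rewrite er (map_uniq uc).
  have sym c1 c2 u' v' : c = c1 ++ u' :: c2 -> v' \in c2 -> G (proj u') (proj v') ->
      exists p', [/\ cycle (near G F (P := P)) (u' :: v' :: p'), uniq (u' :: v' :: p') &
        u' :: v' :: p' =i c].
    by move=> ec /splitPr v'c; case: v'c ec => c5 c4 ec Guv'; exists (c4 ++ c1); apply: adj ec Guv'.
  have [c1 [c2 ec]] : exists c1 c2, c = c1 ++ u :: c2.
    by case/splitPr: uc' => c1 c2; exists c1, c2.
  move: (vc); rewrite {1}ec mem_cat inE eq_sym (negbTE nuv) /= => /orP[vc1|vc2]; last first.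
    by have [p' [? ? ?]] := sym _ _ _ _ ec vc2 Guv; exists u, v, p'; split=> //; left.
  have [c3' [c4 ec1]] : exists c3' c4, c1 = c3' ++ v :: c4.
    by case/splitPr: vc1 => c3' c4; exists c3', c4.
  have ec' : c = c3' ++ v :: (c4 ++ u :: c2) by rewrite ec ec1 -catA.
  have [||p' [? ? ?]] := sym _ _ _ u ec'; first by rewrite mem_cat mem_head orbT.
    by rewrite adj_sym.
  by exists v, u, p'; split=> //; right.
have [sxS syS] : s x \in [set w in c] /\ s y \in [set w in c].
  by rewrite inE sxc inE syc.
have etax : eta (s x) = x := eta_lift s sL x y sxS syS nxy nG.
have etay : eta (s y) = y.
  by apply: (eta_lift s sL y x syS sxS); [rewrite eq_sym|rewrite adj_sym].
exists (map eta p); split; last by rewrite size_map.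
  rewrite -[x in path F x _]etax; apply: (homo_path_in (P := mem c)) ep; last by apply/allP.
  by move=> u v uc' vc'; apply: eta_hom; rewrite inE.
by rewrite -[x in last x _]etax last_map lp etay.
Qed.

Lemma next_system : system picture_graph (lifts P) (rho \o @proj _ _ P) t.+1.
Proof.
have gE s : s \in lifts P -> exists2 g, g \in GG & forall v, proj (s v) = g v.
  by move=> sL; exists [ffun v => proj (s v)]; [apply: (sound_proj sP)|move=> v; rewrite ffunE].
split.
- move=> s sL x y lxy; have [g gG sg] := gE s sL; rewrite /= !sg; exact: (sys_mono sys gG).
- by move=> s sL x y; apply: adjacent_lift.
- move=> phi; have [psi psiP] := tP phi.
  have [g gG cg] := sys_canonical sys psi; have [s sL [sg sphi]] := psiP g gG.
  by exists s => //; apply: canonical_ker cg.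
- by move=> _ s sL x y; apply: (sound_induced sP sL).
- by move=> _; apply: next_clique.
- exact: next_odd.
(* At level 1 the walk is empty, and lifts are injective. *)
move=> s sL x y p ep lp sp; have [t0|] := posnP t; last by move=> t0; apply: next_dist ep lp sp.
move: sp; rewrite t0 ltnS leqn0 => /nilP p0; subst p.
by exists [::]; split=> //; apply: (sound_inj GG_inj sP sL).
Qed.

Lemma next_clean : 0 < t -> clean_lifts F P.
Proof. by move=> t0; apply: (sound_clean sP); apply: (sys_induced sys). Qed.
End Step.

Lemma system_step (v : V) U (G : graph U) GG rho t : system G GG rho t ->
  exists (W : finType) (H : graph W) (HH : {set {ffun V -> W}}) rho', system H HH rho' t.+1 /\
  (0 < t -> {in HH &, forall s s' : {ffun V -> W}, s != s' ->
    (forall x y, s x \in codom s' -> s y \in codom s' -> x = y) \/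
    (exists x y, [/\ F x y, s x \in codom s', s y \in codom s' &
       forall v, s v \in codom s' -> (v == x) || (v == y)])}).
Proof.
move=> sys; have [g gG _] := sys_canonical sys (fun _ => 0).
have [P [sP tP]] := transferring_picture (sys_inj sys) (sys_hom sys) v gG.
exists (point P), (picture_graph sys sP), (lifts P), (rho \o @proj _ _ P).
by split; [apply: next_system|move=> t0; apply: (next_clean sys sP t0)].
Qed.
End Systems.

(** * The ordered graph *)

Section Ranked.
Variables (W : finType) (rho : W -> nat).

Definition ranked : Type := W.

HB.instance Definition _ := Finite.copy ranked W.

(** Lexicographic, with ties of [rho] broken by the enumeration; lifts increase [rho] strictly, so
    no copy sees a tie. *)
Definition ranked_key (w : ranked) : nat := rho w * #|W| + enum_rank (w : W).

Definition ranked_le : rel ranked := fun x y => ranked_key x <= ranked_key y.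

Lemma ranked_key_lt x y : rho x < rho y -> ranked_key x < ranked_key y.
Proof.
move=> lt_xy; rewrite /ranked_key (@leq_trans ((rho x).+1 * #|W|)) //.
  by rewrite mulSn addnC ltn_add2r.
by rewrite (leq_trans _ (leq_addr _ _)) // leq_mul2r lt_xy orbT.
Qed.

Fact ranked_le_refl : reflexive ranked_le. Proof. by move=> x; apply: leqnn. Qed.

Fact ranked_le_anti : antisymmetric ranked_le.
Proof.
move=> x y; rewrite /ranked_le -eqn_leq => /eqP e.
have [lt|gt|er] := ltngtP (rho x) (rho y).
- by have := ranked_key_lt lt; rewrite e ltnn.
- by have := ranked_key_lt gt; rewrite e ltnn.
by move: e; rewrite /ranked_key er => /addnI/ord_inj/enum_rank_inj.
Qed.

Fact ranked_le_trans : transitive ranked_le.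
Proof. by move=> y x z; apply: leq_trans. Qed.

Fact ranked_le_total : total ranked_le. Proof. by move=> x y; apply: leq_total. Qed.

HB.instance Definition _ := Order.Le_isPOrder.Build (Order.Disp tt tt) ranked
  ranked_le_refl ranked_le_anti ranked_le_trans.

HB.instance Definition _ := Order.POrder_isTotal.Build _ ranked ranked_le_total.

Lemma ranked_lt (x y : ranked) : rho x < rho y -> (x < y)%O.
Proof. by move=> /ranked_key_lt lt_xy; rewrite ltNge /Order.le /= /ranked_le -ltnNge. Qed.

Definition ranked_order : finOrderType _ := ranked.
End Ranked.

(** * Odd girth, distance and clique number *)

Section Least.

Lemma least_spec n P : match least n P with
  | Some k => [/\ k < n, P k & forall j, P j -> k <= j]
  | None => forall j, j < n -> ~~ P j end.
Proof.
rewrite /least; have : {in iota 0 n, forall j, 0 <= j < 0 + n}.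
  by move=> j; rewrite mem_iota.
suff H m : match ohead [seq k <- iota m n | P k] with
  | Some k => [/\ m <= k < m + n, P k & forall j, m <= j -> P j -> k <= j]
  | None => forall j, m <= j < m + n -> ~~ P j end.
  move=> _; have := H 0; case: ohead => [k [? ? Hk]|Hk] //; split=> // j; exact: Hk.
elim: n m => [|n IHn] m /=; first by move=> j; lia.
case: ifP => [Pm|nPm] /=; first by split=> //; lia.
have := IHn m.+1; case: ohead => [k [kb Pk Hk]|Hk].
  split=> //; first by lia.
  by move=> j; rewrite leq_eqVlt => /predU1P[<-|]; [rewrite nPm|apply: Hk].
move=> j; have [->|ne] := eqVneq j m; first by rewrite nPm.
by move=> jb; apply: Hk; lia.
Qed.

Lemma least_eq n m (P Q : pred nat) :
  (forall k, k < n -> P k -> exists j, [/\ j <= k, j < m & Q j]) ->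
  (forall k, k < m -> Q k -> exists j, [/\ j <= k, j < n & P j]) -> least n P = least m Q.
Proof.
move=> PQ QP; have := least_spec n P; have := least_spec m Q.
case: (least m Q) => [k [km Qk kmin]|noQ]; case: (least n P) => [l [ln Pl lmin]|noP] //.
- congr Some; apply/eqP; rewrite eqn_leq; apply/andP; split.
    by have [j [jk _ /lmin lj]] := QP k km Qk; apply: leq_trans lj jk.
  by have [j [jl _ /kmin kj]] := PQ l ln Pl; apply: leq_trans kj jl.
- by have [j [_ jn]] := QP k km Qk; rewrite (negbTE (noP j jn)).
by have [j [_ jm]] := PQ l ln Pl; rewrite (negbTE (noQ j jm)).
Qed.
End Least.

Section GraphFacts.
Variables (V : finType) (G : graph V).

Lemma clique_number_ge K : clique G K -> #|K| <= clique_number G.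
Proof. by move=> cK; rewrite /clique_number (bigD1 K) //= leq_maxl. Qed.

Lemma walk_has_path x y p : path G x p -> last x p = y ->
  exists2 j, j <= size p & has_path G x y j.
Proof.
move=> ep <-; case: (shortenP ep) => q eq uq sub.
exists (size q); first by apply: uniq_leq_size => //; case/andP: uq.
by apply/existsP; exists (in_tuple q); rewrite eq eqxx.
Qed.

Lemma odd_closed_walk_cycle c : cycle G c -> odd (size c) ->
  exists j, [/\ j <= size c, odd j & has_cycle G j].
Proof.
have [n] := ubnP (size c); elim: n c => // n IHn c; rewrite ltnS => lt_cn cc oc.
have [/existsP[m /existsP[c' /andP[cc' oc']]]|noc] := boolP
    [exists m : 'I_(size c), exists c' : m.-tuple V, cycle G c' && odd (size c')].
  have lt_c' : size c' < size c by rewrite size_tuple.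
  have [j [jc' oj hj]] := IHn _ (leq_trans lt_c' lt_cn) cc' oc'.
  by exists j; split=> //; rewrite (leq_trans jc') // ltnW.
exists (size c); split=> //; apply/andP; split.
  case: c cc oc {lt_cn noc} => [|x [|y [|? ?]]] //=; by rewrite adj_irr.
apply/existsP; exists (in_tuple c); rewrite /= cc (odd_cycle_uniq cc oc) // => c' cc' oc'.
rewrite leqNgt; apply: contra noc => lt_c'.
by apply/existsP; exists (Ordinal lt_c'); apply/existsP; exists (in_tuple c'); rewrite /= cc'.
Qed.

(* A connection from (x, false) to (x, true) in the bipartite double cover is an
   odd closed walk. *)
Lemma nonbipartite_odd_walk : ~~ bipartite G -> exists c, cycle G c /\ odd (size c).
Proof.
move=> nb.
pose dc (u v : V * bool) := G u.1 v.1 && (u.2 != v.2).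
have dc_sym : symmetric dc by move=> u v; rewrite /dc adj_sym eq_sym.
have [/existsP[x /connectP[p pp lp]]|no] := boolP [exists x, connect dc (x, false) (x, true)].
  have pG : path G x (map fst p).
    rewrite -[x]/((x, false).1) path_map; by apply: sub_path pp => u v /andP[].
  have odd_p : forall q u, path dc u q -> (last u q).2 = u.2 (+) odd (size q).
    elim=> [|v q IHq] u /=; first by rewrite addbF.
    by case/andP=> /andP[_ ne] /IHq->; move: ne; case: u.2; case: v.2; case: (odd _).
  have op := odd_p _ _ pp; rewrite -lp /= in op.
  have lG : last x (map fst p) = x by rewrite -{1}[x]/((x, false).1) last_map -lp.
  move: op; rewrite -(size_map fst); case/lastP: (map fst p) pG lG => // q z pG; rewrite last_rcons => ez.
  by rewrite size_rcons => /esym oq; exists (x :: q); rewrite /= -{2}ez.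
have cs : connect_sym G := sym_connect_sym (adj_sym G).
have ds : connect_sym dc := sym_connect_sym dc_sym.
have lift u q : path G u q -> forall b, exists b', connect dc (u, b) (last u q, b').
  elim: q u => [|v q IHq] u /=; first by move=> _ b; exists b.
  case/andP=> Guv /IHq H b; have [b' cb] := H (~~ b); exists b'.
  by apply: connect_trans cb; apply: connect1; rewrite /dc /= Guv; case: b.
have no' u b : connect dc (u, b) (u, ~~ b) = false.
  by apply: contraNF no => h; apply/existsP; exists u; case: b h => //; rewrite ds.
case/negP: nb; apply/existsP; exists [set x | connect dc (root G x, false) (x, false)].
apply/forallP => x; apply/forallP => y; apply/implyP => Gxy; rewrite !inE.
have er : root G x = root G y by apply/eqP; rewrite root_connect // connect1.
have step b : connect dc (x, b) (y, ~~ b) by apply: connect1; rewrite /dc /= Gxy; case: b.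
rewrite -er; set r := root G x.
have /connectP[q eq lq] : connect G r x by rewrite cs connect_root.
have [b rx] := lift r q eq false; rewrite -lq in rx.
have ry := connect_trans rx (step b).
have tx : connect dc (r, false) (x, false) = ~~ b.
  case: b rx {ry} => // rx; apply: contraFF (no' x true) => rx'.
  by apply: connect_trans rx'; rewrite ds.
have ty : connect dc (r, false) (y, false) = b.
  case: b ry {rx tx} => //= ry; apply: contraFF (no' y true) => ry'.
  by apply: connect_trans ry'; rewrite ds.
by rewrite tx ty; case: (b).
Qed.
End GraphFacts.

Section Final.
Variables (d d' : Order.disp_t) (V : finOrderType d) (F : graph V) (W : finOrderType d').
Variables (H : graph W) (HH : {set {ffun V -> W}}) (rho : W -> nat) (t : nat).
Hypotheses (sys : system F H HH rho t) (t_large : #|V| < t).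
Hypothesis HH_mono : {in HH, forall (s : {ffun V -> W}), {homo s : x y / (x < y)%O}}.
Hypothesis clean : {in HH &, forall s s' : {ffun V -> W}, s != s' ->
    (forall x y, s x \in codom s' -> s y \in codom s' -> x = y) \/
    (exists x y, [/\ F x y, s x \in codom s', s y \in codom s' &
       forall v, s v \in codom s' -> (v == x) || (v == y)])}.
Hypothesis has_edge : exists x y, F x y.

Let t0 : 0 < t. Proof. exact: leq_ltn_trans t_large. Qed.

Lemma lift_adj s x y : s \in HH -> H (s x) (s y) = F x y.
Proof.
by move=> sH; apply/idP/idP; [apply: (sys_induced sys t0 sH)|apply: (sys_hom sys sH)].
Qed.

Definition copies : {set {set W}} := [set [set (s : {ffun V -> W}) x | x : V] | s in HH].

Lemma copies_copy A : A \in copies -> copy F H A.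
Proof.
case/imsetP=> s sH ->; exists s; split=> //; first exact: HH_mono.
by move=> x y; apply: lift_adj.
Qed.

Lemma mem_im (s : {ffun V -> W}) w : (w \in [set s x | x : V]) = (w \in codom s).
Proof. by apply/imsetP/codomP => -[x]; [move=> _ ->; exists x|move=> ->; exists x]. Qed.

Lemma copies_clean A B : A \in copies -> B \in copies -> A <> B -> clean_intersection H A B.
Proof.
case/imsetP=> s sH -> /imsetP[s' s'H ->] nss.
have nst : s != s' by apply/eqP => e; apply: nss; rewrite e.
have IE w : (w \in [set s x | x : V] :&: [set s' x | x : V]) = (w \in codom s) && (w \in codom s').
  by rewrite inE !mem_im.
case: (clean sH s'H nst) => [one|[x [y [Fxy xI yI two]]]]; [left|right].
  apply/card_le1_eqP => u v; rewrite !IE => /andP[/codomP[x ->] xI] /andP[/codomP[y ->] yI].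
  by rewrite (one x y).
have -> : [set s x | x : V] :&: [set s' x | x : V] = [set s x; s y].
  apply/setP => w; rewrite IE !inE; apply/andP/pred2P => [[/codomP[v ->] /two/pred2P[]->]|[]->];
    by [left|right|rewrite codom_f].
rewrite inE; apply/andP; split; apply/edgesP; exists (s x), (s y); split=> //=.
  by rewrite /induced_adj /= !mem_im !codom_f lift_adj.
by rewrite /induced_adj /= !mem_im xI yI lift_adj.
Qed.

Lemma edge_lt e : e \in edges F -> exists x y, [/\ (x < y)%O, F x y & e = [set x; y]].
Proof.
case/edgesP=> x [y [Fxy ->]]; have : x != y by apply: contraTneq Fxy => ->; rewrite adj_irr.
rewrite neq_lt => /orP[lt|gt]; first by exists x, y.
by exists y, x; rewrite adj_sym setUC.
Qed.

Lemma copies_edges s e : s \in HH -> e \in edges (induced H [set s x | x : V]) ->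
  exists2 e', e' \in edges F & e = s @: e'.
Proof.
move=> sH /edgesP[u [v [/and3P[]]]]; rewrite !mem_im => /codomP[x ->] /codomP[y ->].
rewrite lift_adj // => Fxy ->; exists [set x; y]; last by rewrite imsetU !imset_set1.
by apply/edgesP; exists x, y.
Qed.
End Final.

Lemma min_vertex2 (d : Order.disp_t) (T : finOrderType d) (x y : T) :
  (x < y)%O -> min_vertex [set x; y] = Some x.
Proof.
move=> lt_xy; rewrite /min_vertex; case: pickP => [z /andP[]|/(_ x)].
  rewrite !inE => /pred2P[-> //|->] /forall_inP/(_ x); rewrite !inE eqxx leNgt lt_xy => /(_ isT).
  by [].
rewrite !inE eqxx /= => /negbT/forall_inPn[z]; rewrite !inE => /pred2P[]->; first by rewrite lexx.
by rewrite ltW.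
Qed.

Lemma max_vertex2 (d : Order.disp_t) (T : finOrderType d) (x y : T) :
  (x < y)%O -> max_vertex [set x; y] = Some y.
Proof.
move=> lt_xy; rewrite /max_vertex; case: pickP => [z /andP[]|/(_ y)].
  rewrite !inE => /pred2P[->|-> //] /forall_inP/(_ y); rewrite !inE eqxx orbT leNgt lt_xy => /(_ isT).
  by [].
rewrite !inE eqxx orbT /= => /negbT/forall_inPn[z]; rewrite !inE => /pred2P[]->; last by rewrite lexx.
by rewrite ltW.
Qed.

Section Final2.
Variables (d d' : Order.disp_t) (V : finOrderType d) (F : graph V) (W : finOrderType d').
Variables (H : graph W) (HH : {set {ffun V -> W}}) (rho : W -> nat) (t : nat).
Hypotheses (sys : system F H HH rho t) (t_large : #|V| < t).
Hypothesis HH_mono : {in HH, forall (s : {ffun V -> W}), {homo s : x y / (x < y)%O}}.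
Hypothesis has_edge : exists x y, F x y.

Let t0 : 0 < t. Proof. exact: leq_ltn_trans t_large. Qed.
Let HH_inj := sys_inj sys.
Let liftE s x y : s \in HH -> H (s x) (s y) = F x y.
Proof. exact: (lift_adj sys t_large). Qed.

Lemma copies_canonical (phi : {set W} -> nat) :
  exists2 A : {set W}, A \in copies HH & canonical (induced H A) phi.
Proof.
have [s sH can] := sys_canonical sys phi.
exists [set s x | x : V]; first by apply/imsetP; exists s.
have eE e : e \in edges (induced H [set s x | x : V]) -> exists e', [/\ e' \in edges F,
    e = s @: e', min_vertex e = omap s (min_vertex e') & max_vertex e = omap s (max_vertex e')].
  case/(copies_edges sys t_large sH)=> e' e'F ->; exists e'; split=> //;
    have [x [y [lt_xy _ ->]]] := edge_lt e'F; rewrite imsetU !imset_set1;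
    have lt_s := HH_mono sH lt_xy; by rewrite ?min_vertex2 ?max_vertex2.
have oi : injective (omap s) by move=> [x|] [y|] //= [] /(HH_inj sH)->.
case: can => P; [constructor 1|constructor 2|constructor 3|constructor 4] => e1 e2
  /eE[f1 [f1F -> m1 M1]] /eE[f2 [f2F -> m2 M2]].
- exact: P.
- by rewrite m1 m2 P //; split=> [->|/oi].
- by rewrite M1 M2 P //; split=> [->|/oi].
by move/(P _ _ f1F f2F) => ->.
Qed.

Lemma copies_clique : clique_number H = clique_number F.
Proof.
apply/eqP; rewrite eqn_leq; apply/andP; split; apply/bigmax_leqP => K cK.
  (* Cliques that are too small to fold are matched by an edge of [F]. *)
  have [K2|K3] := leqP #|K| 2.
    have [x [y Fxy]] := has_edge; apply: leq_trans K2 _.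
    have nxy : x != y by apply: contraTneq Fxy => ->; rewrite adj_irr.
    have <- : #|[set x; y]| = 2 by rewrite cards2 nxy.
    apply: clique_number_ge; apply/forall_inP => u uK.
    apply/forall_inP => v vK; apply/implyP; move: uK vK; rewrite !inE.
    by case/pred2P=> ->; case/pred2P=> -> //; rewrite ?eqxx // adj_sym.
  have [eta eta_hom] := sys_clique sys t0 cK K3.
  have adjK u v : u \in K -> v \in K -> u != v -> F (eta u) (eta v).
    move=> uK vK nuv; apply: eta_hom => //.
    by move/forall_inP: cK => /(_ u uK)/forall_inP/(_ v vK)/implyP; apply.
  have ei : {in K &, injective eta}.
    move=> u v uK vK e; apply/eqP; apply: contraT => nuv.
    by have := adjK u v uK vK nuv; rewrite e adj_irr.
  rewrite -(card_in_imset ei); apply: clique_number_ge.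
  apply/forall_inP => _ /imsetP[u uK ->]; apply/forall_inP => _ /imsetP[v vK ->].
  by apply/implyP => ne; apply: adjK => //; apply: contraNneq ne => ->.
have [s sH _] := sys_canonical sys (fun _ => 0).
rewrite -(card_imset _ (HH_inj sH)); apply: clique_number_ge.
apply/forall_inP => _ /imsetP[u uK ->]; apply/forall_inP => _ /imsetP[v vK ->].
apply/implyP => ne; rewrite liftE //.
move/forall_inP: cK => /(_ u uK)/forall_inP/(_ v vK)/implyP; apply.
by apply: contraNneq ne => ->.
Qed.

Lemma copies_odd_girth : ~~ bipartite F -> odd_girth H = odd_girth F.
Proof.
move=> nb; apply: least_eq => k _ /andP[ok /andP[k3 /existsP[c /andP[cc uc]]]].
  have [kt|tk] := leqP k t.
    have [||c' [cc' oc' sc']] := sys_odd sys cc; rewrite ?size_tuple //.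
    have [j [jc' oj hj]] := odd_closed_walk_cycle cc' oc'.
    exists j; rewrite ltnS; split; last by rewrite oj.
      by rewrite (leq_trans jc') // (leq_trans sc') // size_tuple.
    case/andP: hj => _ /existsP[c2 /andP[_ /card_uniqP]]; rewrite size_tuple => <-.
    exact: max_card.
  (* Beyond level [t] an odd cycle of [F], of length at most [#|V| < t], is shorter anyway. *)
  have [c' [cc' oc']] := nonbipartite_odd_walk nb.
  have [j [_ oj hj]] := odd_closed_walk_cycle cc' oc'.
  have jV : j <= #|V|.
    case/andP: (hj) => _ /existsP[c2 /andP[_ /card_uniqP]]; rewrite size_tuple => <-.
    exact: max_card.
  exists j; split; [|by rewrite ltnS|by rewrite oj].
  by rewrite (leq_trans jV) // ltnW // (ltn_trans t_large).
have [s sH _] := sys_canonical sys (fun _ => 0).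
have uc' : uniq (map s c) by rewrite (map_inj_uniq (HH_inj sH)).
exists k; split=> //.
  rewrite ltnS -(size_tuple c) -(size_map s) -(card_uniqP uc'); exact: max_card.
rewrite ok /has_cycle k3 /=; apply/existsP; exists (map_tuple s c).
by rewrite /= uc' andbT cycle_map; apply: sub_cycle cc => x y; rewrite /= liftE.
Qed.

Lemma copies_distance : connected F -> forall A, A \in copies HH -> forall x y, x \in A -> y \in A ->
  distance H x y = distance (induced H A) x y.
Proof.
move=> cF _ /imsetP[s sH ->] _ _ /imsetP[a _ ->] /imsetP[b _ ->].
apply: least_eq => k kW /existsP[p /and3P[ep /eqP lp up]]; last first.
  exists k; split=> //; apply/existsP; exists p; rewrite lp eqxx up /= andbT.
  by apply: sub_path ep => u v /and3P[].
have [q [eq lq sq]] : exists q, [/\ path F a q, last a q = b & size q <= k].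
  have [kt|tk] := ltnP k t.
    by have [|q] := sys_dist sys sH ep lp; rewrite ?size_tuple //; exists q.
  (* Here [k] is at least [t], while a path of [F] has fewer than [#|V| < t] edges. *)
  have /connectP[q0 eq0 lq0] := cF a b.
  have [j _ /existsP[q /and3P[eq /eqP lq uq]]] := walk_has_path eq0 (esym lq0).
  exists q; split=> //.
  have := max_card (mem (a :: q)); rewrite (card_uniqP uq) /= => /ltnW/leq_trans; apply.
  by rewrite ltnW // (leq_trans t_large).
have [||j jq hj] := @walk_has_path _ (induced H [set s x | x : V]) (s a) (s b) (map s q).
- rewrite path_map; apply: sub_path eq => u v Fuv /=.
  by rewrite /induced_adj /= liftE // Fuv !mem_im !codom_f.
- by rewrite last_map lq.
rewrite size_map in jq; have jk := leq_trans jq sq.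
by exists j; split=> //; apply: leq_ltn_trans kW.
Qed.
End Final2.

(** * The complete graph as system of level 0 *)

Section Base.
Variables (d : Order.disp_t) (V : finOrderType d) (F : graph V).

Definition complete_graph n : graph 'I_n.
Proof. by exists (fun x y => x != y) => [x y|x]; rewrite 1?eq_sym ?eqxx. Defined.

Definition monotone_maps n : {set {ffun V -> 'I_n}} :=
  [set g : {ffun V -> 'I_n} | [forall x, forall y, (x < y)%O ==> (g x < g y)]].

Lemma monotone_mapsP n (g : {ffun V -> 'I_n}) :
  reflect (forall x y, (x < y)%O -> g x < g y) (g \in monotone_maps n).
Proof.
rewrite inE; apply: (iffP forallP) => [H x y|H x].
  by have /forallP/(_ y)/implyP := H x.
by apply/forallP => y; apply/implyP/H.
Qed.

Definition rank (v : V) := #|[set u | (u < v)%O]|.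

Lemma rank_lt u v : (u < v)%O -> rank u < rank v.
Proof.
move=> lt_uv; apply/proper_card/properP; split.
  by apply/subsetP => w; rewrite !inE => /lt_trans; apply.
by exists u; rewrite inE // ltxx.
Qed.

Lemma rank_bound v : rank v < #|V|.
Proof.
rewrite -cardsT; apply/proper_card/properP; split; first exact: subsetT.
by exists v; rewrite inE // ltxx.
Qed.

(** At level 0 the conditions on odd cycles and distances are void. The four values of [R1] and [R2]
    are the four kinds of canonical colourings. *)
Lemma base_system : exists n, system F (complete_graph n) (monotone_maps n) (@nat_of_ord n) 0.
Proof.
have [N HN] := canonical_ramsey #|V|; exists N.+1.
split=> //.
- by move=> g /monotone_mapsP gm.
- move=> g /monotone_mapsP gm x y Fxy.
  have : x != y by apply: contraTneq Fxy => ->; rewrite adj_irr.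
  by rewrite neq_lt => /orP[] /gm; rewrite /= -val_eqE neq_ltn => ->; rewrite ?orbT.
- move=> phi.
  have [X [R1 [R2 [szX soX ltX kerX]]]] := HN (fun i j => phi [set inord i; inord j : 'I_N.+1]).
  pose x v := nth 0 X (rank v).
  have xX v : x v \in X by rewrite mem_nth // szX rank_bound.
  have xlt u v : (u < v)%O -> x u < x v.
    move=> lt_uv; apply: (sorted_ltn_nth ltn_trans 0 soX) => //; rewrite ?inE ?szX ?rank_bound //.
    exact: rank_lt.
  have xN v : x v < N.+1 by apply: leqW; apply: (allP ltX _ (xX v)).
  have xeq u v : (x u == x v) = (u == v).
    apply/eqP/eqP => [e|->//]; apply/eqP; apply: contraT.
    by rewrite neq_lt => /orP[]/xlt; rewrite e ltnn.
  exists [ffun v => inord (x v)].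
    by apply/monotone_mapsP => u v lt_uv; rewrite !ffunE !inordK ?xlt.
  have eE e : e \in edges F -> exists u v, [/\ (u < v)%O, e = [set u; v],
      min_vertex e = Some u, max_vertex e = Some v &
      phi ([ffun v => inord (x v)] @: e) = phi [set inord (x u); inord (x v) : 'I_N.+1]].
    case/edge_lt=> u [v [lt_uv _ ->]]; exists u, v; split; rewrite ?min_vertex2 ?max_vertex2 //.
    by rewrite imsetU !imset_set1 !ffunE.
  have ker u v u' v' : (u < v)%O -> (u' < v')%O ->
      (phi [set inord (x u); inord (x v) : 'I_N.+1] == phi [set inord (x u'); inord (x v') : 'I_N.+1])
      = (R1 ==> (u == u')) && (R2 ==> (v == v')).
    by move=> lt_uv lt_uv'; rewrite kerX ?xX ?xlt // !xeq.
  have K e e' u v u' v' : e = [set u; v] -> e' = [set u'; v'] -> u = u' -> v = v' -> e = e'.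
    by move=> -> -> -> ->.
  move: ker {kerX}; case: R1; case: R2 => ker; [constructor 4|constructor 2|constructor 3|constructor 1];
    move=> e e' /eE[u [v [lt ee m M pe]]] /eE[u' [v' [lt' ee' m' M' pe']]]; rewrite pe pe' ?m ?m' ?M ?M'.
  + by move/eqP; rewrite ker // => /andP[/eqP eu /eqP ev]; apply: K ee ee' eu ev.
  + split=> [/eqP|[e1]]; first by rewrite ker //= andbT => /eqP->.
    by apply/eqP; rewrite ker // e1 /= eqxx.
  + split=> [/eqP|[e1]]; first by rewrite ker //= => /eqP->.
    by apply/eqP; rewrite ker // e1 /= eqxx.
  by apply/eqP; rewrite ker.
by move=> [|].
Qed.

Lemma all_systems (v : V) t : exists (U : finType) (G : graph U) (GG : {set {ffun V -> U}}) rho,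
  system F G GG rho t.
Proof.
elim: t => [|t [U [G [GG [rho sys]]]]].
  by have [n sys] := base_system; exists 'I_n, (complete_graph n), (monotone_maps n), (@nat_of_ord n).
by have [W [H [HH [rho' [sys' _]]]]] := system_step v sys; exists W, H, HH, rho'.
Qed.
End Base.

Lemma ranked_type (W : finType) (rho : W -> nat) :
  exists (d' : Order.disp_t) (T : finOrderType d') (e : T = W :> finType),
    forall x y : T, rho (ecast W W e x) < rho (ecast W W e y) -> (x < y)%O.
Proof.
(* Only for W in constructor form does the order refer to W itself by conversion. *)
destruct W as [S [c1 c2 c3 c4]]; exists _, (ranked_order rho), erefl => x y.
exact: ranked_lt.
Qed.

Lemma induced_setT (V : finType) (G : graph V) : induced G [set: V] =2 G.
Proof. by move=> x y; rewrite /= /induced_adj /= !inE. Qed.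

Theorem theorem1p1 (d : Order.disp_t) (V : finOrderType d) (F : graph V) :
  exists (d' : Order.disp_t) (W : finOrderType d') (H : graph W)
         (HF : {set {set W}}),
    (forall A : {set W}, A \in HF -> copy F H A) /\
    (forall A B : {set W}, A \in HF -> B \in HF -> A <> B ->
       clean_intersection H A B) /\
    (forall phi : {set W} -> nat,
       exists2 A : {set W}, A \in HF & canonical (induced H A) phi) /\
    clique_number H = clique_number F /\
    (~~ bipartite F -> odd_girth H = odd_girth F) /\
    (connected F ->
       forall A : {set W}, A \in HF ->
       forall x y : W, x \in A -> y \in A ->
       distance H x y = distance (induced H A) x y).
Proof.
have [/existsP[v /existsP[w Fvw]]|noedge] := boolP [exists x, exists y, F x y]; last first.
  have no x y : F x y = false.
    by apply/negbTE; apply: contra noedge => Fxy; apply/existsP; exists x; apply/existsP; exists y.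
  (* Without edges every colouring is monochromatic, and [F] itself serves. *)
  exists d, V, F, [set [set: V]]; split; [|split; [|split; [|split; [|split]]]] => //.
  - move=> A /set1P->; exists id; split=> //; apply/setP => x; rewrite !inE.
    by apply/imsetP; exists x.
  - by move=> A B /set1P-> /set1P->.
  - move=> phi; exists [set: V]; first exact: set11.
    by constructor 1 => e e' /edgesP[x [y []]]; rewrite induced_setT no.
  move=> _ A /set1P-> x y _ _; rewrite /distance /least; congr ohead; apply: eq_filter => k.
  by apply: eq_existsb => p; rewrite (eq_path (induced_setT F)).
(* A level above [#|V|] for cycles and paths; one more passage, from a level with induced copies,
   for cleanness. *)
have [U [G [GG [rho0 sys0]]]] := all_systems F v #|V|.+1.
have [W [H [HH [rho [sys clean]]]]] := system_step v sys0.
have [d' [T [e lt_rho]]] := ranked_type rho; destruct e.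
have mono : {in HH, forall s : {ffun V -> T}, {homo s : x y / (x < y)%O}}.
  by move=> s sH x y /(sys_mono sys sH)/lt_rho.
have edge : exists x y, F x y by exists v, w.
have tl : #|V| < #|V|.+2 by rewrite ltnW.
exists d', T, H, (copies HH); split; [|split; [|split; [|split; [|split]]]].
- exact: (copies_copy sys tl mono).
- exact: (copies_clean sys tl (clean isT)).
- exact: (copies_canonical sys tl mono).
- exact: (copies_clique sys tl edge).
- exact: (copies_odd_girth sys tl).
exact: (copies_distance sys tl).
Qed.
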